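(* Let $n\ge 2$ and let $B$ be a translation invariant convex density basis in $\mathbb{R}^n$, with Busemann-Feller extension $B_{\mathrm{BF}}$. Then $B_{\mathrm{BF}}$ differentiates the same class of non-negative functions as $B$: for every non-negative $f\in L(\mathbb{R}^n)$, $B$ differentiates $\int f$ if and only if $B_{\mathrm{BF}}$ differentiates $\int f$. Moreover, for every non-negative $f\in L(\mathbb{R}^n)$, at almost every point $x\in\mathbb{R}^n$ the integral of $f$ has one and the same type of limits of indeterminacy with respect to $B$ and with respect to $B_{\mathrm{BF}}$.
   Context: $L(\mathbb{R}^n)$ is the class of Lebesgue integrable functions on $\mathbb{R}^n$; $|E|$ is Lebesgue measure. A differentiation basis (basis) $B$ in $\mathbb{R}^n$ is a mapping assigning to each $x\in\mathbb{R}^n$ a family $B(x)$ of bounded measurable sets of positive measure containing $x$, such that there is a sequence $(R_k)$ in $B(x)$ with $\operatorname{diam}R_k\to 0$. For $f\in L(\mathbb{R}^n)$, $\overline{D}_B(\int f,x)$ and $\underline{D}_B(\int f,x)$ denote the upper and lower limits of $\frac{1}{|R|}\int_R f$ over $R\in B(x)$ as $\operatorname{diam}R\to 0$. $B$ differentiates $\int f$ if $\overline{D}_B(\int f,x)=\underline{D}_B(\int f,x)=f(x)$ for almost all $x$. $B$ is translation invariant if $R\in B(x)$ implies $T(R)\in B(T(x))$ for every translation $T$ of $\mathbb{R}^n$; convex if all sets in all $B(x)$ are convex; a density basis if $B$ differentiates $\int\chi_E$ for every bounded measurable set $E\subset\mathbb{R}^n$. The spread of $B$ is $\overline{B}=\bigcup_{x\in\mathbb{R}^n}B(x)$,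 and the Busemann-Feller extension of $B$ is the basis $B_{\mathrm{BF}}(x)=\{R\in\overline{B}: x\in R\}$. Types of limits of indeterminacy: writing $\underline{D}=\underline{D}_B(\int f,x)$, $\overline{D}=\overline{D}_B(\int f,x)$, the integral of $f$ at $x$ has with respect to $B$ exactly one of the seven types: i) $-\infty<\underline{D}=\overline{D}<\infty$; ii) $\underline{D}=\overline{D}=-\infty$; iii) $\underline{D}=\overline{D}=\infty$; iv) $\underline{D}=-\infty$, $\overline{D}=\infty$; v) $-\infty=\underline{D}<\overline{D}<\infty$; vi) $-\infty<\underline{D}<\overline{D}=\infty$; vii) $-\infty<\underline{D}<\overline{D}<\infty$. *)

(* Defs.v *)
From HB Require Import structures.
From mathcomp Require Import all_boot all_order all_algebra.
From mathcomp Require Import all_classical all_reals all_analysis.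

Set Implicit Arguments.
Unset Strict Implicit.
Unset Printing Implicit Defensive.

Import Order.TTheory GRing.Theory Num.Theory.
Import numFieldNormedType.Exports.

Local Open Scope classical_set_scope.
Local Open Scope ring_scope.

(* Lebesgue measure on R^n is built from coverings by countable families of
   half-open boxes `prod_i ]a_i, b_i]`.  A box is coded by its pair of corners
   (a, b); it is empty, with volume 0, as soon as some b_i <= a_i. *)
Section lebesgue_outer.
Context {R : realType} {n : nat}.
Implicit Types (X : set 'rV[R]_n) (C : set ('rV[R]_n * 'rV[R]_n)).

Definition box (ab : 'rV[R]_n * 'rV[R]_n) : set 'rV[R]_n :=
  [set x | forall i, ab.1 0 i < x 0 i <= ab.2 0 i].

Definition box_volume (ab : 'rV[R]_n * 'rV[R]_n) : R :=
  \prod_(i < n) Num.max 0 (ab.2 0 i - ab.1 0 i).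

Definition box_cover X : set (set ('rV[R]_n * 'rV[R]_n)) :=
  [set C | countable C /\ X `<=` \bigcup_(ab in C) box ab].

Definition lebesgue_outer X : \bar R :=
  ereal_inf [set (\esum_(ab in C) (box_volume ab)%:E)%E | C in box_cover X].

Lemma box_volume_ge0 ab : 0 <= box_volume ab.
Proof. by apply: prodr_ge0 => i _; rewrite le_max lexx. Qed.

Local Open Scope ereal_scope.

Let vol_ge0 ab : 0 <= (box_volume ab)%:E.
Proof. by rewrite lee_fin box_volume_ge0. Qed.

Lemma lebesgue_outer_ge0 X : 0 <= lebesgue_outer X.
Proof. by apply: le_ereal_inf_tmp => _ [C _ <-]; exact: esum_ge0. Qed.

Lemma lebesgue_outer0 : lebesgue_outer set0 = 0.
Proof.
apply/eqP; rewrite eq_le lebesgue_outer_ge0 andbT.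
by apply: ereal_inf_lbound; exists set0; [split | rewrite esum_set0].
Qed.

Lemma le_lebesgue_outer : {homo lebesgue_outer : X Y / X `<=` Y >-> X <= Y}.
Proof.
move=> X Y XY; apply: ereal_inf_le_tmp => _ [C [cC YC] <-].
by exists C => //; split=> //; exact: subset_trans YC.
Qed.

Lemma lebesgue_outer_sigma_subadditive : sigma_subadditive lebesgue_outer.
Proof.
move=> A; have [[i ioo]|] := pselect (exists i, lebesgue_outer (A i) = +oo).
  rewrite (eseries_pinfty _ _ ioo) ?leey// => k _.
  by rewrite -ltNye (lt_le_trans _ (lebesgue_outer_ge0 _)).
rewrite -forallNE => Aoo.
apply/lee_addgt0Pr => e e0.
rewrite (le_trans _ (epsilon_trick _ _ (ltW e0)))//; last first.
  by move=> k; exact: lebesgue_outer_ge0.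
have /choice[C PC] : forall k, exists C, box_cover (A k) C /\
    \esum_(ab in C) (box_volume ab)%:E <=
    lebesgue_outer (A k) + (e / (2 ^ k.+1)%:R)%:E.
  move=> k; have ek : (0 < e / (2 ^ k.+1)%:R)%R.
    by rewrite divr_gt0// ltr0n expn_gt0.
  have Afin : lebesgue_outer (A k) \is a fin_num.
    by rewrite ge0_fin_numE ?lebesgue_outer_ge0// ltey; apply/eqP/Aoo.
  have [_ [C cC <-] /ltW Ce] := lb_ereal_inf_adherent ek Afin.
  by exists C.
apply: (@le_trans _ _
    (\esum_(ab in \bigcup_k C k) (box_volume ab)%:E)).
  apply: ereal_inf_lbound; exists (\bigcup_k C k) => //; split.
    by apply: bigcup_countable => // k _; case: (PC k) => -[].
  move=> x [k _ Akx]; have [[_ /(_ _ Akx)[ab Cab xab]] _] := PC k.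
  by exists ab => //; exists k.
rewrite seqDU_bigcup_eq (nneseries_sum_bigcup (@trivIset_seqDU _ C) vol_ge0).
apply: lee_nneseries => [k _ _|k _]; first exact: esum_ge0.
apply: (le_trans _ (PC k).2).
rewrite esum_mkcond [leRHS]esum_mkcond; apply: le_esum => ab _.
case: ifPn => [/set_mem Cab|_]; first by rewrite (mem_set (subset_seqDU Cab)).
by case: ifPn.
Qed.

End lebesgue_outer.

HB.instance Definition _ (R : realType) (n : nat) :=
  isOuterMeasure.Build R 'rV[R]_n (@lebesgue_outer R n)
    lebesgue_outer0 lebesgue_outer_ge0 le_lebesgue_outer
    lebesgue_outer_sigma_subadditive.

Definition lebesgue_outer_measure (R : realType) (n : nat) :
  {outer_measure set 'rV[R]_n -> \bar R} := @lebesgue_outer R n.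

(* R^n with the sigma-algebra of Lebesgue measurable sets (not only the Borel
   sets): by Caratheodory's theorem the outer measure restricts to a complete
   measure on it. *)
Notation Rn R n := (caratheodory_type (lebesgue_outer_measure R n)).

Definition lebesgue {R : realType} {n : nat} : {measure set (Rn R n) -> \bar R} :=
  lebesgue_outer_measure R n.

Section differentiation_bases.
Context {R : realType} {n : nat}.
Implicit Types (B : 'rV[R]_n -> set (set 'rV[R]_n)) (f : 'rV[R]_n -> R).
Implicit Types (S : set 'rV[R]_n) (x v : 'rV[R]_n).

(* The library norm on 'rV[R]_n is the maximum norm; the diameter is Euclidean.
   (Bounded sets are the same for both norms.) *)
Definition euclidean_norm x : R := Num.sqrt (\sum_(i < n) x 0 i ^+ 2).

Definition diam S : \bar R :=
  ereal_sup [set z | exists x y, [/\ S x, S y & z = (euclidean_norm (x - y))%:E]].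

Definition differentiation_basis B : Prop :=
  forall x,
    (forall S, B x S -> [/\ bounded_set S, measurable (S : set (Rn R n)),
                            (0 < lebesgue S)%E & S x]) /\
    (exists S_ : (set 'rV[R]_n)^nat,
        (forall k, B x (S_ k)) /\ diam (S_ k) @[k --> \oo] --> 0%E).

Definition translation_invariant B : Prop :=
  forall x v S, B x S -> B (x + v) [set y + v | y in S].

Definition convex_basis B : Prop := forall x S, B x S -> convex_set S.

Definition spread B : set (set 'rV[R]_n) := \bigcup_x B x.

Definition busemann_feller B : 'rV[R]_n -> set (set 'rV[R]_n) :=
  fun x => [set S | spread B S /\ S x].

Definition mean f S : \bar R :=
  ((lebesgue S)^-1 * \int[lebesgue]_(y in (S : set (Rn R n))) (f y)%:E)%E.

Definition small_sets B x (d : R) : set (set 'rV[R]_n) :=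
  [set S | B x S /\ (diam S < d%:E)%E].

Definition upper_derivative B f x : \bar R :=
  ereal_inf [set ereal_sup (mean f @` small_sets B x d) | d in [set d | 0 < d]].

Definition lower_derivative B f x : \bar R :=
  ereal_sup [set ereal_inf (mean f @` small_sets B x d) | d in [set d | 0 < d]].

Definition L1 f : Prop := (@lebesgue R n).-integrable setT (EFin \o f).

Definition differentiates B f : Prop :=
  {ae @lebesgue R n, forall x, upper_derivative B f x = (f x)%:E /\
                               lower_derivative B f x = (f x)%:E}.

Definition density_basis B : Prop :=
  forall E : set (Rn R n), bounded_set (E : set 'rV[R]_n) -> measurable E ->
    differentiates B \1_E.

End differentiation_bases.

Variant indeterminacy_type :=
  Type_i | Type_ii | Type_iii | Type_iv | Type_v | Type_vi | Type_vii.

(* [dl] and [du] are the lower and the upper derivative *)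
Definition limits_have_type {R : realType} (dl du : \bar R)
    (t : indeterminacy_type) : Prop :=
  match t with
  | Type_i   => [/\ (-oo < dl)%E, dl = du & (du < +oo)%E]
  | Type_ii  => dl = -oo%E /\ du = -oo%E
  | Type_iii => dl = +oo%E /\ du = +oo%E
  | Type_iv  => dl = -oo%E /\ du = +oo%E
  | Type_v   => [/\ dl = -oo%E, (dl < du)%E & (du < +oo)%E]
  | Type_vi  => [/\ (-oo < dl)%E, (dl < du)%E & du = +oo%E]
  | Type_vii => [/\ (-oo < dl)%E, (dl < du)%E & (du < +oo)%E]
  end.

Definition has_indeterminacy_type {R : realType} {n : nat}
    (B : 'rV[R]_n -> set (set 'rV[R]_n)) (f : 'rV[R]_n -> R) (x : 'rV[R]_n)
    (t : indeterminacy_type) : Prop :=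
  limits_have_type (lower_derivative B f x) (upper_derivative B f x) t.

Lemma limits_have_type_exists_unique {R : realType} (dl du : \bar R) :
  (dl <= du)%E -> exists! t, limits_have_type dl du t.
Proof.
move: dl du => [a| |] [b| |] //=; rewrite ?lee_fin => h.
- have [ab|ab] := eqVneq a b.
    exists Type_i; split; first by rewrite /= ltNyr ltry ab.
    by case=> //= [[]|[]|[]|[]|[]|[_]] //; rewrite ab ltxx.
  exists Type_vii; split; first by rewrite /= ltNyr ltry lte_fin lt_neqAle ab h.
  by case=> //= [[_ [/eqP]]|[]|[]|[]|[]|[]] //; rewrite (negbTE ab).
- exists Type_vi; split; first by rewrite /= ltNyr ltry.
  by case=> //= -[].
- exists Type_iii; split; first by [].
  by case=> //= -[].
- exists Type_v; split; first by rewrite /= ltNyr ltry.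
  by case=> //= -[].
- exists Type_iv; split; first by [].
  by case=> //= -[].
- exists Type_ii; split; first by [].
  by case=> //= -[].
Qed.

Lemma busemann_feller_basis {R : realType} {n : nat}
    (B : 'rV[R]_n -> set (set 'rV[R]_n)) :
  differentiation_basis B -> differentiation_basis (busemann_feller B).
Proof.
move=> basisB x; split=> [S [[y _ BS] Sx]|].
  by have [/(_ _ BS)[]] := basisB y.
have [BP [S_ [BS S0]]] := basisB x; exists S_; split=> // k; split.
  by exists x.
by case: (BP _ (BS k)).
Qed.

(* Main.v *)
From HB Require Import structures.
Require Import Defs.
From mathcomp Require Import all_boot all_order all_algebra.
From mathcomp Require Import all_classical all_reals all_analysis.
From mathcomp Require Import measurable_realfun.
From mathcomp Require Import ring lra.

Set Implicit Arguments.
Unset Strict Implicit.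
Unset Printing Implicit Defensive.

Import Order.TTheory GRing.Theory Num.Theory.
Import numFieldNormedType.Exports.

Local Open Scope classical_set_scope.
Local Open Scope ring_scope.

(* Let S range over B(0), so that B(x) consists of the translates x + S, and
   B_BF(x) of the translates x - p + S with p in S.  The heart of the proof is
   [busemann_feller_le]: if g >= 0 and the means of g over x + S are at most lam
   for almost every x in A and all small S, then so are, up to a factor C(n),
   the means of g over the small sets of B_BF(x), for almost every x in A.
   Indeed let Bad(S) be the set of y with a mean of g over y + S larger than lam.
   Since B and (by reflection) the basis x - S are density bases, almost every
   x in A is such that a walk x - a1 + a2 - a3 with steps in S rarely ends in
   Bad(S).  By convexity, three steps are enough to hit z - S in a set of
   measure >= eta |S| outside Bad(S), for every z in x - p + S; integrating over
   z and exchanging the integrals bounds the mean of g over x - p + S.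

   Consequently B_BF is a density basis too, whence f <= lower derivative for
   both bases; with Fatou's lemma along a sequence of B(0), both lower
   derivatives equal f almost everywhere.  So only the types i, vi and vii occur.
   The estimate applied to f transfers the finiteness of the upper derivative,
   and applied to (f - q)^+ (where q is just below f) its equality with f. *)

(** * Lebesgue outer measure *)

Lemma esum_le_sub {R : realType} {T : choiceType} (A B : set T)
    (a : T -> \bar R) :
  (forall y, 0 <= a y)%E -> A `<=` B ->
  (\esum_(y in A) a y <= \esum_(y in B) a y)%E.
Proof.
move=> a0 AB; rewrite esum_mkcond [leRHS]esum_mkcond; apply: le_esum => y _.
case: ifPn => [/set_mem/AB By|_]; first by rewrite (mem_set By).
by case: ifPn.
Qed.

(** [F] need not be injective: a section of [F] over the image turns the left-hand sum into a sum
    over a subset of [C]. *)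
Lemma esum_image_le {R : realType} {T T' : choiceType} (C : set T)
    (F : T -> T') (a : T' -> \bar R) : (forall y, 0 <= a y)%E ->
  (\esum_(y in F @` C) a y <= \esum_(x in C) a (F x))%E.
Proof.
move=> a0; have [->|/set0P[x0 _]] := eqVneq C set0.
  by rewrite image_set0 !esum_set0.
have /choice[s sP] : forall y, exists x, (F @` C) y -> C x /\ F x = y.
  move=> y; have [[x Cx Fx]|ny] := pselect ((F @` C) y); first by exists x.
  by exists x0.
have -> : (\esum_(y in F @` C) a y = \esum_(y in F @` C) a (F (s y)))%E.
  by apply: eq_esum => y /sP[_ ->].
rewrite -(@esum_image _ _ _ _ s (a \o F)); last first.
  move=> y1 y2 /set_mem/sP[_ e1] /set_mem/sP[_ e2] e12.
  by rewrite -e1 -e2 e12.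
by apply: esum_le_sub => [y|_ [y /sP[Cy _] <-]]; first exact: a0.
Qed.

Lemma esum_scale {R : realType} {T : choiceType} (C : set T)
    (a : T -> \bar R) (k : R) : 0 <= k -> (forall y, 0 <= a y)%E ->
  (\esum_(y in C) (k%:E * a y) <= k%:E * \esum_(y in C) a y)%E.
Proof.
move=> k0 a0; rewrite ge_ereal_sup// => _ [X [finX XC] <-].
rewrite -ge0_mule_fsumr//.
apply: lee_wpmul2l; first by rewrite lee_fin.
by apply: ereal_sup_ubound; exists X.
Qed.

Section outer.
Context {R : realType} {n : nat}.
Implicit Types (X Y : set 'rV[R]_n) (ab : 'rV[R]_n * 'rV[R]_n).
Local Notation mu := (@lebesgue_outer R n).

Lemma vol_ge0 ab : (0 <= (box_volume ab)%:E)%E.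
Proof. by rewrite lee_fin box_volume_ge0. Qed.
Hint Resolve vol_ge0 : core.

(** Replacing every box of a cover of [X] by its image under [F] gives a cover of the preimage of
    [X], of total volume at most [k] times as large. Dilations, translations and the reflection are
    all handled in this way. *)
Lemma lebesgue_outer_box_map (F : 'rV[R]_n * 'rV[R]_n -> 'rV[R]_n * 'rV[R]_n)
    (u : 'rV[R]_n -> 'rV[R]_n) (k : R) X : 0 < k ->
  (forall ab y, box ab (u y) -> box (F ab) y) ->
  (forall ab, box_volume (F ab) <= k * box_volume ab) ->
  (mu (u @^-1` X) <= k%:E * mu X)%E.
Proof.
move=> k0 Fbox Fvol.
have H C : box_cover X C ->
    (mu (u @^-1` X) <= k%:E * \esum_(ab in C) (box_volume ab)%:E)%E.
  move=> [cC XC].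
  apply: (@le_trans _ _ (\esum_(ab in F @` C) (box_volume ab)%:E)%E).
    apply: ereal_inf_lbound; exists (F @` C) => //; split.
      exact: (sub_countable (card_image_le _ _)).
    move=> y /XC[ab Cab /Fbox]; exists (F ab) => //; by exists ab.
  apply: le_trans (esum_image_le _ _ _) _ => //.
  apply: le_trans (esum_scale _ (ltW k0) _) => //.
  by apply: le_esum => ab _; rewrite -EFinM lee_fin.
rewrite muleC -lee_pdivrMr//; apply: le_ereal_inf_tmp => _ [C cC <-].
by rewrite lee_pdivrMr// muleC; exact: H.
Qed.

Lemma lebesgue_outer_affine (c : R) (t : 'rV[R]_n) X : 0 < c ->
  mu ((fun y => c *: y + t)%R @^-1` X) = ((c ^- n)%:E * mu X)%E.
Proof.
have key (d : R) (s : 'rV[R]_n) Y : 0 < d ->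
    (mu ((fun y => d *: y + s)%R @^-1` Y) <= (d ^- n)%:E * mu Y)%E.
  move=> d0.
  pose F (ab : 'rV[R]_n * 'rV[R]_n) := (d^-1 *: (ab.1 - s), d^-1 *: (ab.2 - s)).
  apply: (@lebesgue_outer_box_map F); first by rewrite invr_gt0 exprn_gt0.
    move=> ab y h i; have /andP[h1 h2] := h i.
    rewrite /F/= !mxE in h1 h2 *.
    by rewrite ltr_pdivrMl// ler_pdivlMl// ltrBlDr lerBrDr h1 h2.
  move=> ab; rewrite /box_volume -exprVn -[in (d^-1) ^+ n](card_ord n).
  rewrite -prodr_const -big_split/= ler_prod// => i _.
  rewrite le_max lexx/= !mxE -mulrBr opprB addrA subrK.
  by rewrite maxr_pMr ?invr_ge0 ?(ltW d0)// mulr0 lexx.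
move=> c0; apply/eqP; rewrite eq_le key//=.
(* The reverse inequality is the same bound for the inverse map. *)
have := key c^-1 (- (c^-1 *: t)) ((fun y => c *: y + t) @^-1` X).
rewrite invr_gt0 => /(_ c0).
rewrite (_ : _ @^-1` (_ @^-1` _) = X); last first.
  apply/funext => y; rewrite /preimage/= scalerDr scalerN !scalerA.
  by rewrite divff ?gt_eqF// !scale1r subrK.
have cn0 : 0 < c ^+ n by rewrite exprn_gt0.
by rewrite exprVn invrK lee_pdivrMl.
Qed.

Lemma lebesgue_outerN X : mu ((fun y => - y)%R @^-1` X) = mu X.
Proof.
have key Y : (mu ((fun y => - y)%R @^-1` Y) <= mu Y)%E.
  have H (e : R) : 0 < e -> (mu ((fun y => - y)%R @^-1` Y) <= ((1 + e) ^+ n)%:E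
    * mu Y)%E.
    move=> e0.
    (* The boxes are half-open on the left: the reflected box must be enlarged. *)
    pose F (ab : 'rV[R]_n * 'rV[R]_n) := (- ab.2 - e *: (ab.2 - ab.1), - ab.1).
    apply: (@lebesgue_outer_box_map F); first by rewrite exprn_gt0// addr_gt0.
      move=> ab y h i; have /andP[h1 h2] := h i.
      rewrite /F/= !mxE in h1 h2 *.
      have := mulr_gt0 e0 (_ : 0 < ab.2 0 i - ab.1 0 i); lra.
    move=> ab; rewrite /box_volume -[in _ ^+ n](card_ord n).
    rewrite -prodr_const -big_split/= ler_prod// => i _.
    rewrite le_max lexx/= !mxE maxr_pMr ?mulr0; last by lra.
    by rewrite le_eqVlt; apply/orP; left; apply/eqP; congr Num.max; ring.
  have [->|Yfin] := eqVneq (mu Y) +oo%E; first by rewrite leey.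
  have {Yfin} Yfin : mu Y \is a fin_num.
    by rewrite ge0_fin_numE ?lebesgue_outer_ge0// ltey.
  rewrite -(fineK Yfin) in H *.
  (* As [e] tends to 0 from the right, the factor (1 + e)^n disappears. *)
  have lim : ((1 + e) ^+ n * fine (mu Y))%:E @[e --> (0:R)^'+] --> (fine (mu
    Y))%:E.
    apply: cvg_EFin; first by apply: nearW.
    rewrite [X in _ --> X](_ : _ = (1 + 0) ^+ n * fine (mu Y)); last first.
      by rewrite addr0 expr1n mul1r.
    apply: cvgMl; apply: cvg_at_right_filter.
    apply: (cvg_comp (fun e : R => 1 + e) (fun x : R => x ^+ n)).
      by apply: cvgD; [exact: cvg_cst|exact: cvg_id].
    exact: exprn_continuous.
  apply: cvge_ge lim.
  by near=> e; rewrite EFinM; apply: H; near: e; exact: nbhs_right_gt.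
(* Reflection is an involution, so the bound for the reflected set is the converse inequality. *)
apply/eqP; rewrite eq_le key/=.
have := key ((fun y => - y)%R @^-1` X); rewrite (_ : _ @^-1` (_ @^-1` _) = X)//.
by apply/funext => y; rewrite /preimage/= opprK.
Unshelve. all: by end_near.
Qed.

(** The summands are the lengths of the parts of ]a, b] on the two sides of c; [Num.max 0] accounts
    for an empty part. *)
Lemma cut_length (a b c : R) :
  Num.max 0 (Num.min b c - a) + Num.max 0 (b - Num.max a c) <= Num.max 0 (b -
    a).
Proof.
have [bc|cb] := leP b c.
  rewrite [X in _ + X]max_l ?addr0// subr_le0 le_max bc orbT//.
have [ac|ca] := leP a c.
  rewrite [X in X + _]max_r ?[X in _ + X]max_r ?subr_ge0 ?(ltW cb)//.
  by rewrite le_max addrC addrA subrK lexx orbT.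
by rewrite [X in X + _]max_l ?add0r// subr_le0 ltW.
Qed.

(** Caratheodory's criterion is checked on covers: the hyperplane cuts each box into two boxes whose
    volumes add up to at most the original one, since only the edge in direction [i] changes. *)
Lemma halfspace_measurable (i : 'I_n) (c : R) :
  measurable ([set x | x 0 i <= c] : set (Rn R n)).
Proof.
apply: le_caratheodory_measurable => X;
  apply: le_ereal_inf_tmp => _ [C [cC XC] <-].
pose F1 (ab : 'rV[R]_n * 'rV[R]_n) :=
  (ab.1, \row_j (if j == i then Num.min (ab.2 0 j) c else ab.2 0 j)).
pose F2 (ab : 'rV[R]_n * 'rV[R]_n) :=
  (\row_j (if j == i then Num.max (ab.1 0 j) c else ab.1 0 j), ab.2).
apply: (@le_trans _ _ (\esum_(ab in F1 @` C) (box_volume ab)%:E +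
                       \esum_(ab in F2 @` C) (box_volume ab)%:E)%E).
  apply: leeD; apply: ereal_inf_lbound.
    exists (F1 @` C) => //; split;
      first exact: sub_countable (card_image_le _ _) _.
    move=> x [/XC[ab Cab xab] xc]; exists (F1 ab); first by exists ab.
    move=> j; have /andP[h1 h2] := xab j; rewrite /F1/= mxE.
    by case: eqP => [ji|_]; rewrite ?le_min h1 h2// ji.
  exists (F2 @` C) => //; split;
    first exact: sub_countable (card_image_le _ _) _.
  move=> x [/XC[ab Cab xab] /negP]; rewrite -ltNge => xc.
  exists (F2 ab); first by exists ab.
  move=> j; have /andP[h1 h2] := xab j; rewrite /F2/= mxE.
  by case: eqP => [ji|_]; rewrite ?gt_max h1 h2// ji xc.
apply: (@le_trans _ _ (\esum_(ab in C) (box_volume (F1 ab))%:E +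
                       \esum_(ab in C) (box_volume (F2 ab))%:E)%E).
  by apply: leeD; apply: esum_image_le.
rewrite -esumD//; apply: le_esum => ab _; rewrite -EFinD lee_fin.
have volD1 cd : box_volume cd = Num.max 0 (cd.2 0 i - cd.1 0 i) *
    \prod_(j < n | j != i) Num.max 0 (cd.2 0 j - cd.1 0 j) by exact: bigD1.
rewrite !volD1 /= !mxE eqxx.
under eq_bigr => j /negbTE ji do rewrite mxE ji.
under [X in _ * _ + _ * X <= _]eq_bigr => j /negbTE ji do rewrite mxE ji.
rewrite -mulrDl ler_wpM2r//; first by apply: prodr_ge0 => j _;
  rewrite le_max lexx.
exact: cut_length.
Qed.

Lemma measurable_coord (i : 'I_n) :
  measurable_fun setT (fun x : Rn R n => (x : 'rV[R]_n) 0 i).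
Proof.
apply: (measurability _ (RGenOInfty.measurableE R)) => _ [_ [c ->] <-].
rewrite setTI (_ : _ @^-1` _ = ~` [set x : Rn R n | (x : 'rV[R]_n) 0 i <= c]).
  by apply: measurableC; exact: halfspace_measurable.
apply/seteqP; split=> x; rewrite /preimage/= in_itv/= andbT.
  by rewrite ltNge => /negP.
by move/negP; rewrite -ltNge.
Qed.

Lemma box_preimageE ab : box ab =
  \bigcap_(i in [set: 'I_n]) ((fun x : 'rV[R]_n => x 0 i) @^-1` `]ab.1 0 i,
    ab.2 0 i]).
Proof.
apply/seteqP; split=> [x h i _|x h i]; rewrite /preimage/= ?in_itv//=.
by have := h i I; rewrite /preimage/= in_itv.
Qed.

Lemma box_measurable ab : measurable (box ab : set (Rn R n)).
Proof.
rewrite box_preimageE; apply: fin_bigcap_measurable => // i _.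
rewrite -[X in measurable X]setTI; apply: measurable_coord => //.
Qed.

(** The product sigma-algebra on pairs is not completed, so preimages under the difference map are
    treated for Borel sets first; [borel_hull] then leads to Lebesgue measurable sets. *)
Definition borel : set (set 'rV[R]_n) := <<s range (@box R n) >>.

Lemma borel_measurable (A : set (Rn R n)) : borel A -> measurable A.
Proof.
apply: smallest_sub; first exact: sigma_algebra_measurable.
by move=> _ [ab _ <-]; exact: box_measurable.
Qed.

(** The sets with a measurable preimage form a sigma-algebra, and it contains the boxes because the
    coordinates of a difference are measurable. *)
Lemma measurable_diff_preimage (A : set 'rV[R]_n) : borel A ->
  measurable [set p : Rn R n * Rn R n | A ((p.2 : 'rV[R]_n) - (p.1 :
    'rV[R]_n))].
Proof.
pose f (p : Rn R n * Rn R n) : 'rV[R]_n := (p.2 : 'rV[R]_n) - (p.1 : 'rV[R]_n).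
move=> bA; suff : image_set_system setT f measurable A.
  by rewrite /image_set_system/= setTI.
apply: bA; split.
  exact: (sigma_algebra_image f (sigma_algebra_measurable _)).
move=> _ [ab _ <-]; rewrite /image_set_system/= setTI box_preimageE
  preimage_bigcap.
apply: fin_bigcap_measurable => // i _.
have mf : measurable_fun setT (fun p => f p 0 i).
  rewrite /f; under eq_fun do rewrite !mxE.
  apply: measurable_funD; first exact: (measurableT_comp (measurable_coord i)).
  apply: measurableT_comp => //; exact: (measurableT_comp (measurable_coord i)).
by rewrite -[X in measurable X]setTI; exact: mf.
Qed.

(** [E] need not be measurable. [G] is an intersection of covers of [E] by boxes whose total volumes
    tend to the outer measure of [E], so both have the same outer measure; a measurable [M]
    containing [E] then takes up the full measure of [G]. *)
Lemma borel_hull (E : set 'rV[R]_n) : (mu E < +oo)%E ->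
  exists G, [/\ borel G, E `<=` G &
    forall M : set (Rn R n), measurable M -> E `<=` M -> mu (G `\` M) = 0%E].
Proof.
move=> Efin.
have Ef : mu E \is a fin_num by rewrite ge0_fin_numE ?lebesgue_outer_ge0.
have /choice[C CP] : forall k : nat, exists C, box_cover E C /\
   (\esum_(ab in C) (box_volume ab)%:E <= mu E + (k.+1%:R^-1)%:E)%E.
  move=> k; have k0 : 0 < k.+1%:R^-1 :> R by rewrite invr_gt0.
  by have [_ [C cC <-] /ltW h] := lb_ereal_inf_adherent k0 Ef; exists C.
pose O k := \bigcup_(ab in C k) box ab.
pose G := \bigcap_k O k.
have bO k : borel (O k).
  have [[/pfcard_geP[C0|[f]] _] _] := CP k.
    by rewrite /O C0 bigcup_set0; apply: (@sigma_algebra0 _ setT (range box)).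
  rewrite /O (_ : \bigcup_(ab in C k) _ = \bigcup_j box (f j)).
    apply: sigma_algebra_bigcup => j; apply: sub_sigma_algebra.
    by exists (f j).
  apply/seteqP; split=> [x [ab /(@surj _ _ _ _ f)[j _ <-] xj]|x [j _ xj]].
    by exists j.
  by exists (f j) => //; exact: funS.
have bG : borel G.
  have [_ bD bU] : sigma_algebra setT borel by exact: (@smallest_sigma_algebra
    _ setT (range box)).
  rewrite /G -[X in borel X]setCK setC_bigcap -setTD; refine (bD _ _);
    refine (bU _ _) => k.
  by rewrite -setTD; refine (bD _ _).
have EG : E `<=` G.
  by move=> x Ex k _; have [[_ /(_ _ Ex)]] := CP k.
have muG : (mu G <= mu E)%E.
  apply/lee_addgt0Pr => e e0.
  have [k _ /(_ _ (leqnn k)) ke] := near_infty_natSinv_lt (PosNum e0).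
  apply: (@le_trans _ _ (mu (O k)));
    first by apply: le_lebesgue_outer => x /(_ k I).
  have [[cC _] h] := CP k.
  apply: (@le_trans _ _ (mu E + (k.+1%:R^-1)%:E)%E); last first.
    by rewrite leeD2l// lee_fin ltW.
  by apply: le_trans h; apply: ereal_inf_lbound; exists (C k) => //; split.
exists G; split => // M mM EM.
have -> : mu (G `\` M) = (mu G - mu (G `&` M))%E.
  apply: (@measureD _ (Rn R n) R lebesgue) => //; first exact: borel_measurable.
  exact: le_lt_trans muG Efin.
have EGM : (mu E <= mu (G `&` M))%E by apply: le_lebesgue_outer => x Ex;
  split; auto.
have -> : mu (G `&` M) = mu E.
  apply/eqP; rewrite eq_le EGM andbT; apply: le_trans muG.
  by apply: le_lebesgue_outer => x [].
have -> : mu G = mu E.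
  by apply/eqP; rewrite eq_le muG/=; exact: le_lebesgue_outer.
by rewrite subee.
Qed.

End outer.

(** * Cubes and sigma-finiteness *)

Section cubes.
Context {R : realType} {n : nat}.

Definition cube (r : R) : set 'rV[R]_n :=
  box (const_mx (- r) : 'rV[R]_n, const_mx r : 'rV[R]_n).

Lemma cubeE r x : cube r x <-> forall i, - r < x 0 i <= r.
Proof. by split=> h i; have := h i; rewrite !mxE. Qed.

Lemma cube_measurable r : measurable (cube r : set (Rn R n)).
Proof. exact: box_measurable. Qed.

Lemma lebesgue_outer_box_lty ab : (@lebesgue_outer R n (box ab) < +oo)%E.
Proof.
apply: (@le_lt_trans _ _ (\esum_(cd in [set ab]) (box_volume cd)%:E)%E).
  apply: ereal_inf_lbound; exists [set ab] => //.
  by split=> // x xab; exists ab.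
by rewrite esum_set1 ?ltry// lee_fin box_volume_ge0.
Qed.

Lemma cube_lty r : (@lebesgue R n (cube r : set (Rn R n)) < +oo)%E.
Proof. exact: lebesgue_outer_box_lty. Qed.

Lemma ler_mx_norm_coord (x : 'rV[R]_n) i : `|x 0 i| <= `|x|.
Proof.
by rewrite [leRHS]/Num.norm/= mx_normrE; apply/bigmax_geP; right => /=;
  exists (0, i).
Qed.

Lemma bounded_set_cube (S : set 'rV[R]_n) : bounded_set S ->
  exists k : nat, S `<=` cube k%:R.
Proof.
move=> [M [_ /(_ (M + 1))]]; rewrite ltrDl ltr01 => /(_ isT) h.
exists (Num.bound (M + 1)) => x /h/= xM; apply/cubeE => i.
have xi : `|x 0 i| <= M + 1 by apply: le_trans xM; exact: ler_mx_norm_coord.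
have M0 : 0 <= M + 1 by exact: le_trans xi.
have := archi_boundP M0; move: xi; rewrite ler_norml => /andP[? ?] ?.
lra.
Qed.

Lemma cube_bounded r : 0 <= r -> bounded_set (cube r).
Proof.
move=> r0; exists r; split; first exact: num_real.
move=> s rs x /cubeE h; apply: (@le_trans _ _ r); last exact: ltW.
rewrite /Num.norm/= mx_normrE; apply/bigmax_leP; split=> // -[i j] _ /=.
by rewrite ord1 ler_norml; have := h j; lra.
Qed.

Lemma bigcup_cube : \bigcup_k cube k%:R = [set: 'rV[R]_n].
Proof.
apply/seteqP; split=> // x _.
exists (Num.bound `|x|) => //; apply/cubeE => i.
have := ler_mx_norm_coord x i; have := archi_boundP (normr_ge0 x).
by rewrite ler_norml => ? /andP[]; lra.
Qed.

Lemma lebesgue_sigma_finite : sigma_finite setT (@lebesgue R n).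
Proof.
exists (fun k => cube k%:R); first by rewrite bigcup_cube.
by move=> k; split; [exact: cube_measurable|exact: cube_lty].
Qed.

End cubes.

(* [lebesgue] is declared as a bundled measure, which cannot carry the
   sigma-finite structure. *)
Definition lebesgue_sf {R : realType} {n : nat} : set (Rn R n) -> \bar R :=
  @lebesgue R n.

HB.instance Definition _ (R : realType) (n : nat) :=
  Measure.on (@lebesgue_sf R n).
HB.instance Definition _ (R : realType) (n : nat) :=
  Measure_isSigmaFinite.Build _ (Rn R n) R (@lebesgue_sf R n)
    lebesgue_sigma_finite.

(** * Translates and Tonelli's theorem *)

Section translates.
Context {R : realType} {n : nat}.
Implicit Types (S X : set 'rV[R]_n) (x y z t : 'rV[R]_n).
Local Notation mu := (@lebesgue R n).

Definition translate S y : set 'rV[R]_n := [set z | S (z - y)].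
(** This is z - S: y lies in it exactly when z lies in [translate S y], so exchanging the order of
    integration swaps the two. *)
Definition reflected S z : set 'rV[R]_n := [set y | S (z - y)].

(** Caratheodory's criterion involves the outer measure only: every test set is a preimage under
    [u], and the factor [k] comes out on both sides. *)
Lemma measurable_preimage_bij (u v : 'rV[R]_n -> 'rV[R]_n) (k : R) :
  0 <= k -> cancel u v ->
  (forall X, lebesgue_outer (u @^-1` X) = (k%:E * lebesgue_outer X)%E) ->
  forall S : set (Rn R n), measurable S -> measurable (u @^-1` S : set (Rn R
    n)).
Proof.
move=> k0 uv muu S mS; apply: le_caratheodory_measurable => X.
pose Y := v @^-1` X.
have -> : X = u @^-1` Y by apply/funext => x; rewrite /Y /preimage/= uv.
change (lebesgue_outer (u @^-1` (Y `&` S)) + lebesgue_outer (u @^-1` (Y `&` ~`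
  S))
        <= lebesgue_outer (u @^-1` Y))%E.
rewrite !muu -ge0_muleDr ?lebesgue_outer_ge0//.
have -> : lebesgue_outer Y = (lebesgue_outer (Y `&` S) + lebesgue_outer (Y `&`
  ~` S))%E.
  exact: mS.
by [].
Qed.

Lemma lebesgue_tr S y : mu (translate S y) = mu S.
Proof.
have := @lebesgue_outer_affine R n 1 (- y) S ltr01.
rewrite expr1n invr1 mul1e; apply: etrans; apply: (congr1 lebesgue_outer).
by apply/funext => z; rewrite /preimage/= scale1r.
Qed.

Lemma measurable_tr (S : set (Rn R n)) y :
  measurable S -> measurable (translate S y : set (Rn R n)).
Proof.
apply: (@measurable_preimage_bij (fun z => z - y) (fun z => z + y) 1) => //.
  by move=> z; rewrite subrK.
by move=> X; rewrite mul1e; exact: lebesgue_tr.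
Qed.

Lemma lebesgue_rf S z : mu (reflected S z) = mu S.
Proof.
rewrite -(lebesgue_tr S (- z)); apply: etrans (lebesgue_outerN _).
apply: (congr1 lebesgue_outer).
by apply/funext => y; rewrite /preimage/= /reflected /translate/= opprK addrC.
Qed.

Lemma measurable_rf (S : set (Rn R n)) z :
  measurable S -> measurable (reflected S z : set (Rn R n)).
Proof.
apply: (@measurable_preimage_bij (fun y => z - y) (fun y => z - y) 1) => //.
  by move=> y; rewrite opprB addrC subrK.
by move=> X; rewrite mul1e; exact: lebesgue_rf.
Qed.

Lemma lebesgue_dilate S (c : R) t : 0 < c ->
  mu [set y | S (c *: y + t)] = ((c ^- n)%:E * mu S)%E.
Proof. by move=> c0; exact: lebesgue_outer_affine. Qed.

Section tonelli.
Local Open Scope ereal_scope.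
Variables (g h : Rn R n -> \bar R).
Hypotheses (mg : measurable_fun setT g) (mh : measurable_fun setT h).
Hypotheses (g0 : forall x, 0 <= g x) (h0 : forall x, 0 <= h x).

(** Both sides are iterated integrals of h(y) g(z) 1_S(z - y), which is measurable on the product
    because [S] is Borel. *)
Let tonelli_borel S : borel S ->
  measurable_fun setT (fun y : Rn R n => h y * \int[mu]_(z in (translate S y :
    set (Rn R n))) g z) /\
  \int[mu]_y (h y * \int[mu]_(z in (translate S y : set (Rn R n))) g z) =
  \int[mu]_z (g z * \int[mu]_(y in (reflected S z : set (Rn R n))) h y).
Proof.
move=> bS.
pose D := [set p : Rn R n * Rn R n | S ((p.2 : 'rV[R]_n) - (p.1 : 'rV[R]_n))%R].
have mD : measurable D by exact: measurable_diff_preimage.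
pose F (p : Rn R n * Rn R n) := h p.1 * g p.2 * (\1_D p)%:E.
have mF : measurable_fun setT F.
  apply: emeasurable_funM.
    by apply: emeasurable_funM;
      [exact: (measurableT_comp mh)|exact: (measurableT_comp mg)].
  by apply/measurable_EFinP; exact: measurable_indic.
have F0 p : 0 <= F p by rewrite /F !mule_ge0// lee_fin.
have mS : measurable (S : set (Rn R n)) by exact: borel_measurable.
have FE : fubini_F (@lebesgue_sf R n) F =
    (fun y : Rn R n => h y * \int[mu]_(z in (translate S y : set (Rn R n))) g
      z).
  apply/funext => y; rewrite /fubini_F [in RHS]integral_mkcond
    -ge0_integralZl//.
  - apply: eq_integral => z _; rewrite /F/= patchE indicE -muleA; congr (_ * _).
    rewrite (_ : ((y, z) \in D) = (z \in translate S y)); last first.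
      by apply/idP/idP => /set_mem ?; apply/mem_set.
    by case: ifPn; rewrite ?mule1 ?mule0.
  - apply/(measurable_restrictT _ _).1 => //; first exact: measurable_tr.
    exact: measurable_funS mg.
  - by move=> z _; rewrite patchE; case: ifPn.
have GE : fubini_G (@lebesgue_sf R n) F =
    (fun z : Rn R n => g z * \int[mu]_(y in (reflected S z : set (Rn R n))) h
      y).
  apply/funext => z; rewrite /fubini_G [in RHS]integral_mkcond
    -ge0_integralZl//.
  - apply: eq_integral => y _;
    rewrite /F/= patchE indicE (muleC (h y)) -muleA; congr (_ * _).
    rewrite (_ : ((y, z) \in D) = (y \in reflected S z)); last first.
      by apply/idP/idP => /set_mem ?; apply/mem_set.
    by case: ifPn; rewrite ?mule1 ?mule0.
  - apply/(measurable_restrictT _ _).1 => //; first exact: measurable_rf.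
    exact: measurable_funS mh.
  - by move=> y _; rewrite patchE; case: ifPn.
split.
  by rewrite -FE; apply: measurable_fun_fubini_tonelli_F.
by rewrite -FE -GE; exact: (fubini_tonelli (m1 := @lebesgue_sf R n) (m2 :=
  @lebesgue_sf R n)).
Qed.

Let ge0_integral_null_diff (A C : set (Rn R n)) (f : Rn R n -> \bar R) :
  measurable A -> measurable C -> A `<=` C -> mu (C `\` A) = 0 ->
  measurable_fun setT f -> (forall x, 0 <= f x) ->
  \int[mu]_(x in C) f x = \int[mu]_(x in A) f x.
Proof.
move=> mA mC AC CA0 mf f0.
rewrite (@ge0_negligible_integral _ _ _ mu C (C `\` A))//.
- by rewrite setDD setIC (setIidl AC).
- exact: measurableD.
- exact: measurable_funS mf.
Qed.

(** [S] is replaced by a Borel hull [G]: the difference is null, and so are its translates and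
    reflections, hence no inner integral changes. *)
Lemma tonelli_translates (S : set (Rn R n)) : measurable S -> mu S < +oo ->
  measurable_fun setT (fun y : Rn R n => h y * \int[mu]_(z in (translate S y :
    set (Rn R n))) g z) /\
  \int[mu]_y (h y * \int[mu]_(z in (translate S y : set (Rn R n))) g z) =
  \int[mu]_z (g z * \int[mu]_(y in (reflected S z : set (Rn R n))) h y).
Proof.
move=> mS Sfin; have [G [bG SG /(_ _ mS (@subset_refl _ S)) GS0]] := borel_hull
  Sfin.
have mG : measurable (G : set (Rn R n)) by exact: borel_measurable.
have trE y : \int[mu]_(z in (translate S y : set (Rn R n))) g z =
             \int[mu]_(z in (translate G y : set (Rn R n))) g z.
  apply/esym/ge0_integral_null_diff => //;
    [exact: measurable_tr..|by move=> z /SG|].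
  exact: etrans (lebesgue_tr (G `\` S) y) GS0.
have rfE z : \int[mu]_(y in (reflected S z : set (Rn R n))) h y =
             \int[mu]_(y in (reflected G z : set (Rn R n))) h y.
  apply/esym/ge0_integral_null_diff => //;
    [exact: measurable_rf..|by move=> y /SG|].
  exact: etrans (lebesgue_rf (G `\` S) z) GS0.
under eq_fun do rewrite trE.
under [in RHS]eq_integral do rewrite rfE.
exact: tonelli_borel.
Qed.

End tonelli.

Lemma measurable_integral_tr (S : set (Rn R n)) (g : Rn R n -> \bar R) :
  measurable S -> (mu S < +oo)%E ->
  measurable_fun setT g -> (forall x, 0 <= g x)%E ->
  measurable_fun setT (fun y : Rn R n => \int[mu]_(z in (translate S y : set
    (Rn R n))) g z)%E.
Proof.
move=> mS Sfin mg g0.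
have [+ _] := @tonelli_translates g (cst 1%E) mg (@measurable_cst _ _ _ _ _ _)
  g0
  (fun=> lee01) S mS Sfin.
by under eq_fun do rewrite mul1e.
Qed.

Lemma measurable_integral_rf (S : set (Rn R n)) (g : Rn R n -> \bar R) :
  measurable S -> (mu S < +oo)%E ->
  measurable_fun setT g -> (forall x, 0 <= g x)%E ->
  measurable_fun setT (fun y : Rn R n => \int[mu]_(z in (reflected S y : set
    (Rn R n))) g z)%E.
Proof.
move=> mS Sfin mg g0.
(* [reflected S y] is the translate of -S by y. *)
have mN : measurable ([set x | S (- (x : 'rV[R]_n))%R] : set (Rn R n)).
  rewrite (_ : [set x | _] = reflected S 0); first exact: measurable_rf.
  by apply/funext => x; rewrite /reflected/= add0r.
have Nfin : (mu [set x | S (- (x : 'rV[R]_n))%R] < +oo)%E.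
  by rewrite (lebesgue_outerN S : mu [set x | S (- (x : 'rV[R]_n))%R] = mu S).
have := measurable_integral_tr mN Nfin mg g0.
congr measurable_fun; apply/funext => y; congr (integral mu _ _).
by apply/funext => z; rewrite /translate /reflected/= opprB.
Qed.

Lemma measurable_lebesgue_setI_tr (S A : set (Rn R n)) :
  measurable S -> (mu S < +oo)%E -> measurable A ->
  measurable_fun setT (fun y : Rn R n => mu (A `&` translate S y)).
Proof.
move=> mS Sfin mA.
have := @measurable_integral_tr S (EFin \o \1_A) mS Sfin.
under eq_fun do rewrite (@integral_indic _ _ _ mu _ (measurable_tr _ mS) A mA).
by apply => [|x]; [exact/measurable_EFinP/measurable_indic|rewrite lee_fin].
Qed.

Lemma measurable_lebesgue_setI_rf (S A : set (Rn R n)) :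
  measurable S -> (mu S < +oo)%E -> measurable A ->
  measurable_fun setT (fun y : Rn R n => mu (A `&` reflected S y)).
Proof.
move=> mS Sfin mA.
have := @measurable_integral_rf S (EFin \o \1_A) mS Sfin.
under eq_fun do rewrite (@integral_indic _ _ _ mu _ (measurable_rf _ mS) A mA).
by apply => [|x]; [exact/measurable_EFinP/measurable_indic|rewrite lee_fin].
Qed.

Lemma diam_tr S y : diam (translate S y) = diam S.
Proof.
congr ereal_sup; apply/seteqP; split=> z [a [b [Sa Sb ->]]].
  by exists (a - y), (b - y); split=> //; rewrite opprB addrA subrK.
exists (a + y), (b + y); rewrite /translate/= !addrK; split=> //.
by rewrite opprD addrACA subrr addr0.
Qed.

Lemma diam_lt_coord S (x y : 'rV[R]_n) i (d : R) :
  (diam S < d%:E)%E -> S x -> S y -> `|x 0 i - y 0 i| < d.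
Proof.
move=> Sd Sx Sy; rewrite -lte_fin; apply: le_lt_trans Sd.
apply: (@le_trans _ _ (euclidean_norm (x - y))%:E); last first.
  by apply: ereal_sup_ubound; exists x, y.
rewrite lee_fin -sqrtr_sqr ler_sqrt; last by apply: sumr_ge0 => j _;
  exact: sqr_ge0.
by rewrite (bigD1 i)//= !mxE lerDl sumr_ge0// => j _; exact: sqr_ge0.
Qed.

Lemma small_sub_cube S (x : 'rV[R]_n) (r : R) :
  (diam S < 1%:E)%E -> S x -> cube r x -> S `<=` cube (r + 1).
Proof.
move=> Sd Sx /cubeE rx y Sy; apply/cubeE => i.
have := diam_lt_coord i Sd Sx Sy; have := rx i.
by rewrite ltr_norml => /andP[? ?] /andP[? ?]; lra.
Qed.

End translates.

(** * Almost every point sees few bad points *)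

Section ae_utils.
Context {R : realType} {n : nat}.
Local Notation mu := (@lebesgue R n).

Lemma ae_forall_nat (P : nat -> 'rV[R]_n -> Prop) :
  (forall k, {ae mu, forall x, P k x}) -> {ae mu, forall x, forall k, P k x}.
Proof.
move=> h; have := negligible_bigcup h;
  apply: negligibleS => x /= /existsNP[k nP].
by exists k.
Qed.

Lemma ae_mono (P Q : 'rV[R]_n -> Prop) : (forall x, P x -> Q x) ->
  {ae mu, forall x, P x} -> {ae mu, forall x, Q x}.
Proof.
by move=> PQ; apply: negligibleS => x /= nQ Px; apply: nQ; exact: PQ.
Qed.

Lemma ae_and (P Q : 'rV[R]_n -> Prop) : {ae mu, forall x, P x} ->
  {ae mu, forall x, Q x} -> {ae mu, forall x, P x /\ Q x}.
Proof.
move=> hP hQ; have := negligibleU hP hQ; apply: negligibleS => x /= nPQ.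
by have [Px|] := pselect (P x); [right=> Qx; exact: nPQ|left].
Qed.

Lemma mean_le (f : 'rV[R]_n -> R) (T : set (Rn R n)) (c : R) :
  (0 < mu T)%E -> (mu T < +oo)%E ->
  (mean f T <= c%:E)%E = (\int[mu]_(y in T) (f y)%:E <= c%:E * mu T)%E.
Proof.
move=> T0 Tfin; rewrite /mean.
have Tf : mu T \is a fin_num by rewrite ge0_fin_numE// ltW.
rewrite -(fineK Tf) inver gt_eqF ?fine_gt0 ?T0// lee_pdivrMl ?fine_gt0 ?T0//.
by rewrite [in RHS]muleC.
Qed.

Lemma mean_ge (f : 'rV[R]_n -> R) (T : set (Rn R n)) (c : R) :
  (0 < mu T)%E -> (mu T < +oo)%E ->
  (c%:E <= mean f T)%E = (c%:E * mu T <= \int[mu]_(y in T) (f y)%:E)%E.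
Proof.
move=> T0 Tfin; rewrite /mean.
have Tf : mu T \is a fin_num by rewrite ge0_fin_numE// ltW.
rewrite -(fineK Tf) inver gt_eqF ?fine_gt0 ?T0// lee_pdivlMl ?fine_gt0 ?T0//.
by rewrite [in RHS]muleC.
Qed.

End ae_utils.

(** * Sets of the basis at the origin and sparse bad sets *)

Section step.
Context {R : realType} {n : nat}.
Variable B : 'rV[R]_n -> set (set 'rV[R]_n).
Hypotheses (basisB : differentiation_basis B) (transB : translation_invariant
  B).
Local Notation mu := (@lebesgue R n).
Implicit Types (S : set 'rV[R]_n) (x y z : 'rV[R]_n).

Lemma basisP x (T : set (Rn R n)) : B x T ->
  [/\ measurable T, (0 < mu T)%E, (mu T < +oo)%E & T x].
Proof.
move=> BT; have [/(_ _ BT)[bT mT T0 Tx] _] := basisB x; split => //.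
have [k Tk] := bounded_set_cube bT.
by apply: le_lt_trans (cube_lty k%:R); exact: le_lebesgue_outer.
Qed.

Lemma basis_tr x S : B 0 S -> B x (translate S x).
Proof.
move=> /(transB x); rewrite add0r; congr B; apply/seteqP; split=> y /=.
  by move=> [z Sz <-]; rewrite /translate/= addrK.
by move=> Sy; exists (y - x) => //; rewrite subrK.
Qed.

Lemma basis_trP x T : B x T -> exists2 S, B 0 S & T = translate S x.
Proof.
move=> /(transB (- x)); rewrite subrr => BT; eexists; first exact: BT.
apply/seteqP; split=> y; rewrite /translate/=; first by exists y.
by move=> [z Tz /addIr <-].
Qed.

(** Only sets of [B 0] are considered: by translation invariance, those of [B x] are their
    translates. *)
Definition for_small (P : set 'rV[R]_n -> Prop) : Prop :=
  exists2 d : R, 0 < d & forall S, B 0 S -> (diam S < d%:E)%E -> P S.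

Lemma for_small_and P Q : for_small P -> for_small Q -> for_small (fun S => P S
  /\ Q S).
Proof.
move=> [d d0 hP] [e e0 hQ]; exists (Num.min d e); first by rewrite lt_min d0.
by move=> S BS; rewrite EFin_min lt_min => /andP[? ?]; split;
  [exact: hP|exact: hQ].
Qed.

Lemma for_small_mono (P Q : set 'rV[R]_n -> Prop) :
  (forall S, B 0 S -> P S -> Q S) -> for_small P -> for_small Q.
Proof. by move=> PQ [d d0 h]; exists d => // S BS Sd; apply: PQ => //;
  exact: h. Qed.

Lemma for_small_diam (d : R) : 0 < d -> for_small (fun S => (diam S < d%:E)%E).
Proof. by move=> d0; exists d. Qed.

Lemma upper_derivative_lt (C : 'rV[R]_n -> set (set 'rV[R]_n)) f x (c : R) :
  (upper_derivative C f x < c%:E)%E ->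
  exists2 d : R, 0 < d & forall T, C x T -> (diam T < d%:E)%E -> (mean f T <=
    c%:E)%E.
Proof.
move=> /ereal_inf_lt[_ [d /= d0 <-] h]; exists d => // T CT Td.
by apply: le_trans (ltW h); apply: ereal_sup_ubound; exists T.
Qed.

Lemma upper_derivative_le (C : 'rV[R]_n -> set (set 'rV[R]_n)) f x (c d : R) :
  0 < d -> (forall T, C x T -> (diam T < d%:E)%E -> (mean f T <= c%:E)%E) ->
  (upper_derivative C f x <= c%:E)%E.
Proof.
move=> d0 h; apply: (@le_trans _ _ (ereal_sup (mean f @` small_sets C x d))).
  by apply: ereal_inf_lbound; exists d.
by apply: ge_ereal_sup => _ [T [CT Td] <-]; exact: h.
Qed.

Lemma lower_derivative_gt (C : 'rV[R]_n -> set (set 'rV[R]_n)) f x (c : R) :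
  (c%:E < lower_derivative C f x)%E ->
  exists2 d : R, 0 < d & forall T, C x T -> (diam T < d%:E)%E -> (c%:E <= mean
    f T)%E.
Proof.
move=> /ereal_sup_gt[_ [d /= d0 <-] h]; exists d => // T CT Td.
by apply: le_trans (ltW h) _; apply: ereal_inf_lbound; exists T.
Qed.

Lemma lower_derivative_ge (C : 'rV[R]_n -> set (set 'rV[R]_n)) f x (c d : R) :
  0 < d -> (forall T, C x T -> (diam T < d%:E)%E -> (c%:E <= mean f T)%E) ->
  (c%:E <= lower_derivative C f x)%E.
Proof.
move=> d0 h; apply: (@le_trans _ _ (ereal_inf (mean f @` small_sets C x d))).
  by apply: le_ereal_inf_tmp => _ [T [CT Td] <-]; exact: h.
by apply: ereal_sup_ubound; exists d.
Qed.

(** This is the density property at points outside [F], for the family of the sets [op S x] with [S]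
    in [B 0]. *)
Definition sparse_op (op : set 'rV[R]_n -> 'rV[R]_n -> set 'rV[R]_n) :=
  forall F : set (Rn R n), bounded_set (F : set 'rV[R]_n) -> measurable F ->
  {ae mu, forall x, ~ F x -> forall eta : R, 0 < eta ->
     for_small (fun S => mu (F `&` op S x) <= eta%:E * mu S)%E}.

Hypothesis densityB : density_basis B.

(** At almost every point outside [F] the upper derivative of the indicator of [F] is 0, hence below
    every eta. *)
Lemma sparse_tr : sparse_op translate.
Proof.
move=> F bF mF; have := densityB bF mF; apply: ae_mono => x [ux _] nFx eta eta0.
have : (upper_derivative B \1_F x < eta%:E)%E.
  by rewrite ux indicE memNset// lte_fin.
move=> /upper_derivative_lt[d d0 h]; exists d => // S BS Sd.
have := h _ (basis_tr x BS); rewrite diam_tr => /(_ Sd).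
have [mS S0 Sfin _] := basisP BS.
rewrite mean_le ?lebesgue_tr//; apply: le_trans.
by rewrite -integral_indic//; exact: measurable_tr.
Qed.

(** Since x - S = -(-x + S), the claim for [F] at x is the one for -F and translates at -x;
    reflection preserves null sets. *)
Lemma sparse_rf : sparse_op reflected.
Proof.
move=> F bF mF.
pose NF : set (Rn R n) := [set x | F (- (x : 'rV[R]_n))].
have mNF : measurable NF.
  rewrite (_ : NF = reflected F 0); first exact: measurable_rf.
  by apply/funext => x; rewrite /reflected/= add0r.
have bNF : bounded_set (NF : set 'rV[R]_n).
  move: bF => [M [Mr h]]; exists M; split=> // K MK x /= /(h K MK).
  by rewrite /= normrN.
have [N [mN N0 sN]] := sparse_tr bNF mNF.
exists [set x | N (- (x : 'rV[R]_n))]; split.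
- rewrite (_ : [set x | _] = reflected N 0) ; first exact: measurable_rf.
  by apply/funext => x; rewrite /reflected/= add0r.
- exact: etrans (lebesgue_outerN N) N0.
move=> x /= nx; apply: sN => /= h; apply: nx => nFx eta eta0.
have := h _ eta eta0; rewrite /NF/= opprK => /(_ nFx);
  apply: for_small_mono => S BS.
apply: le_trans; rewrite le_eqVlt; apply/orP; left; apply/eqP.
apply: etrans (lebesgue_outerN _); apply: (congr1 lebesgue_outer).
apply/funext => z; rewrite /translate /reflected /preimage/=; congr (_ /\ S _).
  by rewrite opprK.
by rewrite opprK addrC.
Qed.

Variable op : set 'rV[R]_n -> 'rV[R]_n -> set 'rV[R]_n.
Hypotheses (opP : sparse_op op)
  (op_cube : forall S x r, B 0 S -> (diam S < 1%:E)%E -> cube r x ->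
     op S x `<=` cube (r + 1)).

(* The points of A that avoid [Bad S] uniformly for all small S need not form a
   measurable set, but each [Bad S] is negligible in their measurable hull, which
   has density one at almost all of them. *)
Lemma sparse_step (Bad : set 'rV[R]_n -> set (Rn R n)) (A : set 'rV[R]_n) (eta
  : R) :
  0 < eta -> (forall S, B 0 S -> measurable (Bad S)) ->
  {ae mu, forall x, A x -> for_small (fun S => ~ Bad S x)} ->
  {ae mu, forall x, A x -> for_small (fun S => mu (Bad S `&` op S x) <= eta%:E
    * mu S)%E}.
Proof.
move=> eta0 mBad aeBad.
(* Countably many sets exhaust the relevant points of [A]: [m] gives a uniform threshold for the
   diameter, [k] a cube that makes the outer measure finite. *)
pose E (m k : nat) : set 'rV[R]_n := [set x | [/\ A x, cube k%:R x &
  forall S, B 0 S -> (diam S < (m.+1%:R^-1)%:E)%E -> ~ Bad S x]].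
have /choice[G GP] : forall mk : nat * nat, exists G, [/\ borel G, E mk.1 mk.2
  `<=` G &
    forall M : set (Rn R n), measurable M -> E mk.1 mk.2 `<=` M -> mu (G `\` M)
      = 0%E].
  move=> [m k]; apply: borel_hull; apply: le_lt_trans (cube_lty k%:R).
  by apply: le_lebesgue_outer => x [].
(* Sparseness of [F] at points of [E m k] means that most of [op S x] lies in the hull [G]; the
   added 1 leaves room for [op S x] inside the cube. *)
pose F mk : set (Rn R n) := cube (mk.2%:R + 1) `\` G mk.
have aeF : {ae mu, forall x, forall m k, ~ F (m, k) x -> forall eta : R, 0 <
  eta ->
     for_small (fun S => mu (F (m, k) `&` op S x) <= eta%:E * mu S)%E}.
  apply: ae_forall_nat => m; apply: ae_forall_nat => k; apply: opP.
    have := @cube_bounded R n (k%:R + 1);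
      rewrite addr_ge0// => /(_ isT) [M [Mr h]].
    by exists M; split=> // K MK x [] /(h K MK).
  apply: measurableD; first exact: cube_measurable.
  by apply: borel_measurable; case: (GP (m, k)).
apply: ae_mono (ae_and aeBad aeF) => x [xBad xF] Ax.
have [d d0 dP] := xBad Ax.
have [m _ /(_ _ (leqnn m)) md] := near_infty_natSinv_lt (PosNum d0).
have [k _ xk] : (\bigcup_k cube k%:R) x by rewrite bigcup_cube.
have [bG EG GM] := GP (m, k).
have Ex : E m k x.
  by split=> // S BS Sm; apply: dP => //; apply: lt_trans Sm _; rewrite lte_fin.
have nF : ~ F (m, k) x by move=> [_]; apply; exact: EG.
have m0 : 0 < m.+1%:R^-1 :> R by rewrite invr_gt0.
apply: for_small_mono (for_small_and (xF m k nF eta eta0) (for_small_and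
  (for_small_diam ltr01) (for_small_diam m0))).
move=> S BS [h [S1 Sm]].
(* The bad points in [G] are null, as [E m k] lies in the complement of [Bad S]; the other ones in
   [op S x] lie in [F]. *)
apply: (@le_trans _ _ (mu (G (m, k) `\` ~` Bad S) + mu (F (m, k) `&` op S
  x))%E).
  apply: le_trans (outer_measureU2 (lebesgue_outer_measure R n) _ _).
  apply: le_lebesgue_outer => z [Bz oz].
  have [Gz|nGz] := pselect (G (m, k) z); first by left; split=> // /(_ Bz).
  by right; split=> //; split=> //=; exact: (op_cube BS S1 xk).
rewrite GM ?add0e//; first by apply: measurableC; exact: mBad.
by move=> y [_ _ /(_ S BS Sm)].
Qed.

End step.

Section step_translates.
Context {R : realType} {n : nat}.
Variable B : 'rV[R]_n -> set (set 'rV[R]_n).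
Hypotheses (basisB : differentiation_basis B) (transB : translation_invariant B)
  (densityB : density_basis B).
Local Notation mu := (@lebesgue R n).
Variables (Bad : set 'rV[R]_n -> set (Rn R n)) (A : set 'rV[R]_n) (eta : R).
Hypotheses (eta0 : 0 < eta) (mBad : forall S, B 0 S -> measurable (Bad S))
  (aeBad : {ae mu, forall x, A x -> for_small B (fun S => ~ Bad S x)}).

Lemma sparse_step_tr :
  {ae mu, forall x, A x -> for_small B (fun S => mu (Bad S `&` translate S x)
    <= eta%:E * mu S)%E}.
Proof.
apply: (sparse_step (sparse_tr basisB transB densityB)) => // S x r BS S1 rx.
have [_ _ _ S0] := basisP basisB BS.
by apply: (@small_sub_cube _ _ _ x); rewrite ?diam_tr// /translate/= subrr.
Qed.

Lemma sparse_step_rf :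
  {ae mu, forall x, A x -> for_small B (fun S => mu (Bad S `&` reflected S x)
    <= eta%:E * mu S)%E}.
Proof.
apply: (sparse_step (sparse_rf basisB transB densityB)) => // S x r BS S1
  /cubeE rx y Sy.
have [_ _ _ S0] := basisP basisB BS.
apply/cubeE => i; have := diam_lt_coord i S1 Sy S0; have := rx i.
by rewrite !mxE ltr_norml => /andP[? ?] /andP[? ?]; lra.
Qed.

End step_translates.

(** * Means over the Busemann-Feller extension *)

Section geometry.
Context {R : realType} {n : nat}.
Local Notation mu := (@lebesgue R n).
Implicit Types (x y z p s v : 'rV[R]_n).

Lemma convex_mid (S : set 'rV[R]_n) a b : convex_set S -> S a -> S b ->
  S (2^-1 *: a + 2^-1 *: b).
Proof.
move=> cS Sa Sb.
have h0 : 0 <= 2^-1 :> R by lra.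
have h1 : 2^-1 <= 1 :> R by lra.
have := cS a b (Itv01 h0 h1) (mem_set Sa) (mem_set Sb).
rewrite inE [X in S X](_ : _ = 2^-1 *: a + (1 - 2^-1) *: b)//.
by rewrite (_ : 1 - 2^-1 = 2^-1 :> R)//; lra.
Qed.

(** Markov's inequality, for any measurable set on which the lower bound holds. *)
Lemma cst_mul_measure_le (D : set (Rn R n)) (f : Rn R n -> \bar R) (k : \bar R)
  :
  measurable D -> measurable_fun setT f -> (forall y, 0 <= f y)%E -> (0 <= k)%E
    ->
  (forall y, D y -> k <= f y)%E -> (k * mu D <= \int[mu]_y f y)%E.
Proof.
move=> mD mf f0 k0 kf; rewrite -integral_cst//.
apply: (@le_trans _ _ (\int[mu]_(y in D) f y)%E);
  last exact: ge0_subset_integral.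
apply: ge0_le_integral => //.
exact: measurable_funS mf.
Qed.

Variable S : set (Rn R n).
Hypotheses (mS : measurable S) (S_gt0 : (0 < mu S)%E) (S_fin : (mu S < +oo)%E).

Lemma lebesgue_dilate_rf (c : R) x : 0 < c ->
  mu [set y | S (c *: (x - y))] = ((c ^- n)%:E * mu S)%E.
Proof.
move=> c0; rewrite -(@lebesgue_dilate _ _ S c 0 c0).
rewrite -[RHS](lebesgue_rf _ x); apply: (congr1 lebesgue_outer).
by apply/funext => y; rewrite /reflected/= addr0.
Qed.

Lemma lebesgue_dilate_tr (c : R) x : 0 < c ->
  mu [set y | S (c *: (y - x))] = ((c ^- n)%:E * mu S)%E.
Proof.
move=> c0; rewrite -(@lebesgue_dilate _ _ S c 0 c0).
rewrite -[RHS](lebesgue_tr _ x); apply: (congr1 lebesgue_outer).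
by apply/funext => y; rewrite /translate/= addr0.
Qed.

Definition overlap v (c : R) : set (Rn R n) :=
  [set y | (c%:E * mu S <= mu (translate S v `&` translate S y))%E].

Lemma overlap_measurable v c : measurable (overlap v c).
Proof.
have mI := measurable_lebesgue_setI_tr mS S_fin (measurable_tr v mS).
have := emeasurable_fun_c_infty measurableT mI (c%:E * mu S)%E.
by rewrite setTI.
Qed.

(** Tonelli's theorem with h = 1: the inner integral becomes the measure of a reflected set, which
    is |S|. *)
Lemma integral_lebesgue_setI_tr (A : set (Rn R n)) : measurable A ->
  (\int[mu]_y mu (A `&` translate S y) = mu A * mu S)%E.
Proof.
move=> mA.
pose f1 : Rn R n -> \bar R := EFin \o \1_A.
have m1 : measurable_fun setT f1.
  by apply/measurable_EFinP; exact: measurable_indic.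
have A0 x : (0 <= f1 x)%E by rewrite lee_fin.
have [_ tE] := tonelli_translates m1 (@measurable_cst _ _ _ _ setT 1%E) A0
  (fun=> lee01) mS S_fin.
transitivity (\int[mu]_y (1 * \int[mu]_(z in (translate S y : set (Rn R n))) f1
  z))%E.
  apply: eq_integral => y _.
  by rewrite mul1e [RHS](@integral_indic _ _ _ mu _ (measurable_tr y mS) _ mA).
apply: (etrans tE).
transitivity (\int[mu]_z (mu S * f1 z))%E.
  apply: eq_integral => z _.
  have -> : (\int[mu]_(y in (reflected S z : set (Rn R n))) cst 1 y = mu S)%E.
    apply: etrans (integral_cst mu (measurable_rf z mS) 1%E) _.
    by rewrite mul1e; exact: lebesgue_rf.
  exact: muleC.
rewrite (ge0_integralZl mu measurableT m1 (fun x _ => A0 x) (measure_ge0 mu S)).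
have /= -> := @integral_indic _ _ _ mu _ measurableT _ mA.
by rewrite setIT muleC.
Qed.

(** Markov's inequality for the measure of the intersection of v + S and y + S, whose integral over
    y is |S|^2. *)
Lemma lebesgue_overlap v c : 0 < c -> (c%:E * mu (overlap v c) <= mu S)%E.
Proof.
move=> c0.
have Sf : mu S \is a fin_num by rewrite ge0_fin_numE// ltW.
have S0 : 0 < fine (mu S) by rewrite fine_gt0// S_gt0.
have cS0 : (0 <= c%:E * mu S)%E by rewrite mule_ge0// lee_fin ltW.
have mI := measurable_lebesgue_setI_tr mS S_fin (measurable_tr v mS).
have := cst_mul_measure_le (overlap_measurable v c) mI (fun y => measure_ge0 mu
  _) cS0
   (fun y oy => oy).
rewrite (integral_lebesgue_setI_tr (measurable_tr v mS)).
rewrite (lebesgue_tr S v : mu (translate S v) = mu S) -(fineK Sf) muleAC.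
by rewrite lee_pmul2r.
Qed.

(** Double counting of the pairs (y, z) with y in [G] and z in both y + S and v + S, weighted by
    g(z). Integrating in z first gives at most lam |S| |G|; integrating in y first gives at least a
    |S| times the integral over v + S. Then |S| cancels. *)
Lemma integral_tr_le (g : Rn R n -> \bar R) (G : set (Rn R n)) v (lam a : R) :
  measurable_fun setT g -> (forall x, 0 <= g x)%E -> measurable G ->
  0 < lam -> 0 < a ->
  (forall y, G y -> \int[mu]_(z in (translate S y : set (Rn R n))) g z <=
    lam%:E * mu S)%E ->
  (forall z, translate S v z -> a%:E * mu S <= mu (G `&` reflected S z))%E ->
  (a%:E * \int[mu]_(z in (translate S v : set (Rn R n))) g z <= lam%:E * mu
    G)%E.
Proof.
move=> mg g0 mG lam0 a0 Gle aG.
have Sf : mu S \is a fin_num by rewrite ge0_fin_numE// ltW.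
have S0 : 0 < fine (mu S) by rewrite fine_gt0// S_gt0.
have mtS y : measurable (translate S y : set (Rn R n)) by exact: measurable_tr.
pose g' : Rn R n -> \bar R := (g \_ (translate S v : set (Rn R n))).
have mg' : measurable_fun setT g'.
  by apply/(measurable_restrictT _ (mtS v)).1; exact: measurable_funS mg.
have g'0 x : (0 <= g' x)%E by rewrite /g' patchE; case: ifP.
have g'g x : (g' x <= g x)%E by rewrite /g' patchE; case: ifP.
pose h : Rn R n -> \bar R := EFin \o \1_G.
have mh : measurable_fun setT h by apply/measurable_EFinP;
  exact: measurable_indic.
have h0 x : (0 <= h x)%E by rewrite lee_fin.
have Ig'0 y : (0 <= \int[mu]_(z in (translate S y : set (Rn R n))) g' z)%E.
  by apply: integral_ge0 => z _; exact: g'0.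
have Ih0 y : (0 <= \int[mu]_(z in (reflected S y : set (Rn R n))) h z)%E.
  by apply: integral_ge0 => z _; exact: h0.
have lS0 : (0 <= lam%:E * mu S)%E by rewrite mule_ge0// lee_fin ltW.
have aS0 : (0 <= a%:E * mu S)%E by rewrite mule_ge0// lee_fin ltW.
have mIg' := measurable_integral_tr mS S_fin mg' g'0.
have mIh := measurable_integral_rf mS S_fin mh h0.
have le1 : (\int[mu]_y (h y * \int[mu]_(z in (translate S y : set (Rn R n))) g'
  z)
           <= (lam%:E * mu S) * mu G)%E.
  rewrite [leRHS](_ : _ = \int[mu]_y (lam%:E * mu S * h y))%E; last first.
    rewrite (ge0_integralZl mu measurableT mh (fun x _ => h0 x) lS0).
    by have /= -> := @integral_indic _ _ _ mu _ measurableT _ mG; rewrite setIT.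
  apply: ge0_le_integral.
  - exact: measurableT.
  - by move=> y _; exact: mule_ge0.
  - exact: emeasurable_funM.
  - by apply: emeasurable_funM => //; exact: measurable_cst.
  - move=> y _; rewrite muleC; have [Gy|nGy] := pselect (G y); last first.
      by rewrite /h/= indicE memNset// !mule0.
    apply: lee_wpmul2r => //; apply: le_trans (Gle y Gy).
    apply: ge0_le_integral; [exact: mtS|by move=> *; exact: g'0|
      exact: measurable_funS mg'|exact: measurable_funS mg|
      by move=> *; exact: g'g].
have le2 : (a%:E * mu S * \int[mu]_(z in (translate S v : set (Rn R n))) g z <=
   \int[mu]_z (g' z * \int[mu]_(y in (reflected S z : set (Rn R n))) h y))%E.
  rewrite integral_mkcond -/g'.
  rewrite -(ge0_integralZl mu measurableT mg' (fun x _ => g'0 x) aS0).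
  apply: ge0_le_integral.
  - exact: measurableT.
  - by move=> z _; exact: mule_ge0.
  - by apply: emeasurable_funM => //; exact: measurable_cst.
  - exact: emeasurable_funM.
  - move=> z _; rewrite muleC; have [vz|nvz] := pselect (translate S v z);
    last first.
      by rewrite /g' patchE memNset// !mul0e.
    apply: lee_wpmul2l => //; apply: le_trans (aG z vz) _.
    by have /= -> := @integral_indic _ _ _ mu _ (measurable_rf z mS) _ mG.
have [_ tE] := tonelli_translates mg' mh g'0 h0 mS S_fin.
rewrite tE in le1.
have := le_trans le2 le1.
rewrite -(fineK Sf) muleAC [leRHS]muleAC.
by rewrite lee_pmul2r.
Qed.

End geometry.

(** * Three-step walks and the bound on one translate *)

Section halo.
Context {R : realType} {n : nat}.
Local Notation mu := (@lebesgue R n).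
Implicit Types (x y z p s v : 'rV[R]_n).

(** A quarter-size copy of [S] has relative measure 4^-n; if at most half of this amount is bad, the
    other half remains. *)
Local Notation eta := (4 ^- n / 2 : R).

(** One step of the walk: from a heavy point, more than the fraction [eta] of the steps along [op S]
    lead into [Bad]. *)
Definition heavy (op : set 'rV[R]_n -> 'rV[R]_n -> set 'rV[R]_n) (S Bad : set
  (Rn R n)) :
    set (Rn R n) := [set y | (eta%:E * mu S < mu (Bad `&` op S y))%E].

Lemma eta_gt0 : 0 < eta.
Proof. by rewrite divr_gt0// invr_gt0 exprn_gt0. Qed.

Variable S : set (Rn R n).
Hypotheses (mS : measurable S) (S_gt0 : (0 < mu S)%E) (S_fin : (mu S < +oo)%E).

Lemma heavy_measurable_tr (Bad : set (Rn R n)) : measurable Bad -> measurable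
  (heavy translate S Bad).
Proof.
move=> mBad; have := emeasurable_fun_o_infty measurableT
  (measurable_lebesgue_setI_tr mS S_fin mBad) (eta%:E * mu S)%E.
by rewrite setTI.
Qed.

Lemma heavy_measurable_rf (Bad : set (Rn R n)) : measurable Bad -> measurable
  (heavy reflected S Bad).
Proof.
move=> mBad; have := emeasurable_fun_o_infty measurableT
  (measurable_lebesgue_setI_rf mS S_fin mBad) (eta%:E * mu S)%E.
by rewrite setTI.
Qed.

(** A set of admissible steps with measure above eta |S| cannot lie in [Bad]; this selects the next
    point of the walk. *)
Lemma not_heavy_meets op (Bad : set (Rn R n)) x (D : set 'rV[R]_n) (c : R) :
  eta < c -> mu D = (c%:E * mu S)%E -> D `<=` op S x -> ~ heavy op S Bad x ->
  exists2 y, D y & ~ Bad y.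
Proof.
move=> etac muD Dop nh; apply: contrapT => h; apply: nh; rewrite /heavy/=.
apply: (@lt_le_trans _ _ (mu D)).
  have Sf : mu S \is a fin_num by rewrite ge0_fin_numE// ltW.
  by rewrite muD (lte_pmul2r Sf S_gt0) lte_fin.
apply: le_lebesgue_outer => y Dy; split; last exact: Dop.
by apply: contrapT => nB; apply: h; exists y.
Qed.

Hypothesis cS : convex_set (S : set 'rV[R]_n).

Lemma convex_quarter a b c : S a -> S b -> S c ->
  S (2^-1 *: a + 4^-1 *: b + 4^-1 *: c).
Proof.
move=> Sa Sb Sc; have := convex_mid cS Sa (convex_mid cS Sb Sc).
by congr S; apply/rowP => i; rewrite !mxE; lra.
Qed.

(* The steps are a1 = p/2 + b/2, a2 = s/2 + b/4 + d/4 and a3 = p/2 + d/4 + e/4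
   with b, d, e in S: then y = x - a1 + a2 - a3 has z - y = s/2 + b/4 + e/4 in S
   for z = x - p + s.  Once b and d are fixed, y ranges over a set of measure
   4^-n |S|.  The overlap set only serves to confine y to a set of measure
   comparable to |S|. *)
Lemma not_heavy_overlap (Bad : set (Rn R n)) x p s : S p -> S s ->
  ~ heavy reflected S (heavy translate S (heavy reflected S Bad)) x ->
  (eta%:E * mu S <=
   mu ((overlap S (x - p) (2 ^- n) `\` Bad) `&` reflected S (x - p + s)))%E.
Proof.
move=> Sp Ss.
have half_gt0 : 0 < 4 ^- n :> R by rewrite invr_gt0 exprn_gt0.
have eta4 : eta < 4 ^- n by lra.
have eta2 : eta < 2 ^- n.
  apply: lt_le_trans eta4 _; rewrite lef_pV2 ?posrE ?exprn_gt0//.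
  by rewrite lerXn2r ?nnegrE//; lra.
(* The points x - a1, with b ranging over [S]. *)
pose D1 := [set y | S (2 *: (x - 2^-1 *: p - y))].
move=> /(not_heavy_meets eta2 (lebesgue_dilate_rf S (x - 2^-1 *: p) _ : mu D1 =
  _))[//||y1 Db].
  move=> y Dy; have := convex_mid cS Sp Dy; rewrite /reflected/=.
  by congr S; apply/rowP => i; rewrite !mxE; lra.
pose b := 2 *: (x - 2^-1 *: p - y1); have {}Db : S b by exact: Db.
(* The points y1 + a2, with d ranging over [S]. *)
pose D2 := [set y | S (4 *: (y - (y1 + 2^-1 *: s + 4^-1 *: b)))].
move=> /(not_heavy_meets eta4 (lebesgue_dilate_tr S _ _ : mu D2 = _))[//||y2
  Dd].
  move=> y Dy; have := convex_quarter Ss Db Dy; rewrite /translate/=.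
  by congr S; apply/rowP => i; rewrite !mxE; lra.
pose d := 4 *: (y2 - (y1 + 2^-1 *: s + 4^-1 *: b));
  have {}Dd : S d by exact: Dd.
(* The points y2 - a3, with e ranging over [S]; here a whole set of good endpoints is kept, not a
   single one. *)
pose D3 := [set y | S (4 *: (y2 - 2^-1 *: p - 4^-1 *: d - y))].
move=> nh3.
have Sf : mu S \is a fin_num by rewrite ge0_fin_numE// ltW.
have muD3 : mu D3 = ((4 ^- n)%:E * mu S)%E by exact: lebesgue_dilate_rf.
have h3 : (mu (Bad `&` reflected S y2) <= eta%:E * mu S)%E.
  by rewrite leNgt; apply/negP.
have D3rf : D3 `<=` reflected S y2.
  move=> y Dy; have := convex_quarter Sp Dd Dy; rewrite /reflected/=.
  by congr S; apply/rowP => i; rewrite !mxE; lra.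
have : (mu D3 <= mu (D3 `\` Bad) + mu (Bad `&` reflected S y2))%E.
  apply: le_trans (outer_measureU2 (lebesgue_outer_measure R n) _ _).
  apply: le_lebesgue_outer => y Dy.
  by have [By|nBy] := pselect (Bad y); [right; split=> //; exact: D3rf|left].
move=> /le_trans/(_ (leeD2l _ h3)); rewrite muD3 -leeBlDr ?fin_numM//.
rewrite -muleBl// ?fin_num_adde_defl// -EFinB (_ : 4 ^- n - eta = eta);
  last by lra.
move=> /le_trans; apply; apply: le_lebesgue_outer => y [Dy nBy].
pose e := 4 *: (y2 - 2^-1 *: p - 4^-1 *: d - y); have {}Dy : S e by exact: Dy.
(* The free parameter d cancels between the second and the third step. *)
have yE : y = x - p + 2^-1 *: s - 4^-1 *: b - 4^-1 *: e.
  by apply/rowP => i; rewrite !mxE; lra.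
have zy : reflected S (x - p + s) y.
  have := convex_quarter Ss Db Dy; rewrite /reflected/= yE.
  by congr S; apply/rowP => i; rewrite !mxE; lra.
split=> //; split=> //; rewrite /overlap/=.
(* The half-size copy x - p + s/2 + S/2, of measure 2^-n |S|, lies in both translates by
   convexity. *)
rewrite -(lebesgue_dilate_tr S (x - p + 2^-1 *: s))//.
apply: le_lebesgue_outer => w Dw; rewrite /translate/=; split.
  have := convex_mid cS Ss Dw.
  by congr S; apply/rowP => i; rewrite !mxE; lra.
have := convex_mid cS Dw (convex_mid cS Db Dy); rewrite yE.
by congr S; apply/rowP => i; rewrite !mxE; lra.
Qed.

(** Double counting over the good part of the overlap set. The constant 2 * 8^n is 2^n, which bounds
    the relative measure of that set, divided by [eta]. *)
Lemma integral_translate_le (g : Rn R n -> \bar R) (lam : R) x p :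
  measurable_fun setT g -> (forall x, 0 <= g x)%E -> 0 < lam -> S p ->
  ~ heavy reflected S (heavy translate S (heavy reflected S
      [set y | lam%:E * mu S < \int[mu]_(z in (translate S y : set (Rn R n))) g
        z]%E)) x ->
  (\int[mu]_(z in (translate S (x - p) : set (Rn R n))) g z <= (2 * 8 ^+ n *
    lam)%:E * mu S)%E.
Proof.
move=> mg g0 lam0 Sp; set Bad := [set y | _] => nh.
have mBad : measurable (Bad : set (Rn R n)).
  have := emeasurable_fun_o_infty measurableT (measurable_integral_tr mS S_fin
    mg g0) (lam%:E * mu S)%E.
  by rewrite setTI.
pose G := overlap S (x - p) (2 ^- n) `\` Bad.
have mo := overlap_measurable mS S_fin (x - p) (2 ^- n).
have mG : measurable (G : set (Rn R n)) by exact: measurableD.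
have Gle y : G y -> (\int[mu]_(z in (translate S y : set (Rn R n))) g z <=
  lam%:E * mu S)%E.
  by move=> [_ /negP]; rewrite -leNgt.
have Gge z : translate S (x - p) z -> (eta%:E * mu S <= mu (G `&` reflected S
  z))%E.
  move=> Ss; have := not_heavy_overlap Sp Ss nh.
  by rewrite [x - p + _]addrC subrK.
have Gfin : (mu G <= (2 ^+ n)%:E * mu S)%E.
  have n2 : 0 < 2 ^- n :> R by rewrite invr_gt0 exprn_gt0.
  apply: (@le_trans _ _ (mu (overlap S (x - p) (2 ^- n)))).
    by apply: le_lebesgue_outer => y [].
  have := lebesgue_overlap mS S_gt0 S_fin (x - p) n2.
  by rewrite lee_pdivrMl// exprn_gt0.
have := integral_tr_le mS S_gt0 S_fin mg g0 mG lam0 eta_gt0 Gle Gge.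
have /(lee_wpmul2l (_ : 0 <= lam%:E)%E) : (mu G <= (2 ^+ n)%:E * mu S)%E by [].
move=> /(_ _)/[swap] /le_trans h; rewrite lee_fin => /(_ (ltW lam0))/h.
rewrite muleA -EFinM -[eta]invrK lee_pdivrMl ?invr_gt0 ?eta_gt0// muleA -EFinM.
congr (_ <= _%:E * _)%E.
rewrite invf_div invrK (_ : 8 = 4 * 2 :> R); last by lra.
by rewrite exprMn; ring.
Qed.

End halo.

(** * Transfer of bounds on means to the Busemann-Feller extension *)

Section halo_theorem.
Context {R : realType} {n : nat}.
Variable B : 'rV[R]_n -> set (set 'rV[R]_n).
Hypotheses (basisB : differentiation_basis B) (transB : translation_invariant B)
  (convexB : convex_basis B) (densityB : density_basis B).
Local Notation mu := (@lebesgue R n).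

Lemma busemann_fellerP x (T : set 'rV[R]_n) : busemann_feller B x T ->
  exists S p, [/\ B 0 S, S p & T = translate S (x - p)].
Proof.
move=> [[y _ /(basis_trP transB)[S BS ->]] Sxy]; exists S, (x - y); split => //.
by rewrite subKr.
Qed.

Lemma busemann_feller_le (g : Rn R n -> \bar R) (lam : R) (A : set 'rV[R]_n) :
  measurable_fun setT g -> (forall x, 0 <= g x)%E -> 0 < lam ->
  {ae mu, forall x, A x ->
    for_small B (fun S => \int[mu]_(z in (translate S x : set (Rn R n))) g z <=
      lam%:E * mu S)%E} ->
  {ae mu, forall x, A x -> exists2 d : R, 0 < d & forall T : set (Rn R n),
    busemann_feller B x T -> (diam T < d%:E)%E ->
    (\int[mu]_(z in T) g z <= (2 * 8 ^+ n * lam)%:E * mu T)%E}.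
Proof.
move=> mg g0 lam0 h.
pose Bad0 (S : set 'rV[R]_n) : set (Rn R n) :=
  [set y | (lam%:E * mu S < \int[mu]_(z in (translate S y : set (Rn R n))) g
    z)%E].
have mBad0 S : B 0 S -> measurable (Bad0 S).
  move=> BS; have [mS S_gt0 S_fin _] := basisP basisB BS.
  have := emeasurable_fun_o_infty measurableT (measurable_integral_tr mS S_fin
    mg g0) (lam%:E * mu S)%E.
  by rewrite setTI.
have h0 : {ae mu, forall x, A x -> for_small B (fun S => ~ Bad0 S x)}.
  apply: ae_mono h => x xA Ax; apply: for_small_mono (xA Ax) => S BS le.
  by rewrite /Bad0/= => /(le_lt_trans le); rewrite ltxx.
(* The walk is built from its last step backwards, alternating reflected sets and translates; each
   sparse step keeps almost every point of [A] outside the new bad set for small [S]. *)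
pose Bad1 S := heavy reflected S (Bad0 S).
pose Bad2 S := heavy translate S (Bad1 S).
pose Bad3 S := heavy reflected S (Bad2 S).
have mBad1 S : B 0 S -> measurable (Bad1 S).
  move=> BS; have [mS S_gt0 S_fin _] := basisP basisB BS.
  exact: heavy_measurable_rf mS S_fin _ (mBad0 S BS).
have mBad2 S : B 0 S -> measurable (Bad2 S).
  move=> BS; have [mS S_gt0 S_fin _] := basisP basisB BS.
  exact: heavy_measurable_tr mS S_fin _ (mBad1 S BS).
have h1 : {ae mu, forall x, A x -> for_small B (fun S => ~ Bad1 S x)}.
  apply: ae_mono (sparse_step_rf basisB transB densityB (@eta_gt0 R n) mBad0
    h0) => x xA Ax.
  apply: for_small_mono (xA Ax) => S BS le.
  by rewrite /Bad1 /heavy/= => /(le_lt_trans le); rewrite ltxx.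
have h2 : {ae mu, forall x, A x -> for_small B (fun S => ~ Bad2 S x)}.
  apply: ae_mono (sparse_step_tr basisB transB densityB (@eta_gt0 R n) mBad1
    h1) => x xA Ax.
  apply: for_small_mono (xA Ax) => S BS le.
  by rewrite /Bad2 /heavy/= => /(le_lt_trans le); rewrite ltxx.
have h3 : {ae mu, forall x, A x -> for_small B (fun S => ~ Bad3 S x)}.
  apply: ae_mono (sparse_step_rf basisB transB densityB (@eta_gt0 R n) mBad2
    h2) => x xA Ax.
  apply: for_small_mono (xA Ax) => S BS le.
  by rewrite /Bad3 /heavy/= => /(le_lt_trans le); rewrite ltxx.
(* The exceptional null set does not depend on p, so all sets of the extension at x are treated at
   once. *)
apply: ae_mono h3 => x xA Ax; have [d d0 dP] := xA Ax; exists d => // T.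
move=> /busemann_fellerP[S [p [BS Sp ->]]]; rewrite diam_tr => Sd.
have [mS S_gt0 S_fin _] := basisP basisB BS.
rewrite (lebesgue_tr S (x - p) : mu (translate S (x - p)) = mu S).
have := @integral_translate_le R n S mS S_gt0 S_fin (convexB BS) g lam x p mg
  g0 lam0 Sp.
by apply; exact: dP.
Qed.

End halo_theorem.

(** * Upper and lower derivatives *)

Section derivatives.
Context {R : realType} {n : nat}.
Variable B : 'rV[R]_n -> set (set 'rV[R]_n).
Hypotheses (basisB : differentiation_basis B) (transB : translation_invariant B)
  (convexB : convex_basis B) (densityB : density_basis B).
Local Notation mu := (@lebesgue R n).
Local Notation BF := (busemann_feller B).

Let basisBF : differentiation_basis BF := busemann_feller_basis basisB.

Lemma sub_busemann_feller x (T : set 'rV[R]_n) : B x T -> BF x T.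
Proof.
by move=> BT; have [_ _ _ Tx] := basisP basisB BT; split=> //; exists x.
Qed.

Lemma lower_busemann_feller f x : (lower_derivative BF f x <= lower_derivative
  B f x)%E.
Proof.
apply: ge_ereal_sup => _ [d d0 <-].
apply: (@le_trans _ _ (ereal_inf (mean f @` small_sets B x d))); last first.
  by apply: ereal_sup_ubound; exists d.
apply: ereal_inf_le_tmp => _ [T [BT Td] <-]; exists T => //.
by split=> //; exact: sub_busemann_feller.
Qed.

Lemma upper_busemann_feller f x : (upper_derivative B f x <= upper_derivative
  BF f x)%E.
Proof.
apply: le_ereal_inf_tmp => _ [d d0 <-].
apply: (@le_trans _ _ (ereal_sup (mean f @` small_sets B x d))).
  by apply: ereal_inf_lbound; exists d.
apply: ereal_sup_le => _ [T [BT Td] <-]; exists T => //.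
by split=> //; exact: sub_busemann_feller.
Qed.

Lemma lower_le_upper f x : (lower_derivative B f x <= upper_derivative B f x)%E.
Proof.
apply: ge_ereal_sup => _ [d /= d0 <-];
  apply: le_ereal_inf_tmp => _ [e /= e0 <-].
(* A set of the shrinking sequence at x with diameter below both thresholds compares the infimum
   with the supremum. *)
have [_ [T_ [BT T0]]] := basisB x.
have de0 : 0 < Num.min d e by rewrite lt_min d0.
have : \forall k \near \oo, (diam (T_ k) < (Num.min d e)%:E)%E.
  move/fine_cvgP : T0 => [fin cv].
  near=> k.
  have fk : diam (T_ k) \is a fin_num by near: k.
  rewrite -(fineK fk) lte_fin; near: k.
  exact: (cvgr_lt 0 cv).
move=> [k _ /(_ _ (leqnn k))]; rewrite EFin_min lt_min => /andP[kd ke].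
apply: (@le_trans _ _ (mean f (T_ k))).
  by apply: ereal_inf_lbound; exists (T_ k).
by apply: ereal_sup_ubound; exists (T_ k).
Unshelve. all: by end_near.
Qed.

Lemma nat_inv_lt (e : R) : 0 < e -> exists m : nat, m.+1%:R^-1 < e.
Proof.
by move=> e0; have [m _ /(_ _ (leqnn m))] := near_infty_natSinv_lt (PosNum e0);
  exists m.
Qed.

(** This is [busemann_feller_le] for the indicator of [F], with the bounds 1/(m+1) on the complement
    of [F]; as m is arbitrary, the constant factor is harmless. *)
Lemma sparse_busemann_feller (F : set (Rn R n)) : bounded_set (F : set
  'rV[R]_n) ->
  measurable F -> {ae mu, forall x, ~ F x -> forall eta : R, 0 < eta ->
    exists2 d : R, 0 < d & forall T, BF x T -> (diam T < d%:E)%E ->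
      (mu (F `&` T) <= eta%:E * mu T)%E}.
Proof.
move=> bF mF.
pose g : Rn R n -> \bar R := EFin \o \1_F.
have mg : measurable_fun setT g by apply/measurable_EFinP;
  exact: measurable_indic.
have g0 x : (0 <= g x)%E by rewrite lee_fin.
have gE (T : set (Rn R n)) : measurable T -> (\int[mu]_(z in T) g z = mu (F `&`
  T))%E.
  by move=> mT; rewrite (@integral_indic _ _ _ mu _ mT _ mF).
have h : {ae mu, forall x, forall m : nat, ~ F x -> exists2 d : R, 0 < d &
  forall T : set (Rn R n),
    BF x T -> (diam T < d%:E)%E ->
    (\int[mu]_(z in T) g z <= (2 * 8 ^+ n * m.+1%:R^-1)%:E * mu T)%E}.
  apply: ae_forall_nat => m; have m0 : 0 < m.+1%:R^-1 :> R by rewrite invr_gt0.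
  apply: (busemann_feller_le basisB transB convexB densityB mg g0 m0).
  apply: ae_mono (sparse_tr basisB transB densityB bF mF) => x xF nFx.
  apply: for_small_mono (xF nFx _ m0) => S BS.
  have [mS _ _ _] := basisP basisB BS.
  by rewrite gE//; exact: measurable_tr.
apply: ae_mono h => x xF nFx eta eta0.
have C0 : 0 < 2 * 8 ^+ n :> R by rewrite mulr_gt0// exprn_gt0.
have [m mP] := nat_inv_lt (divr_gt0 eta0 C0).
have [d d0 dP] := xF m nFx; exists d => // T BT Td.
have [mT T0 Tfin _] := basisP basisBF BT.
have := dP T BT Td; rewrite gE// => /le_trans; apply.
apply: lee_wpmul2r; first exact: measure_ge0.
by rewrite lee_fin mulrC -ler_pdivlMr// ltW.
Qed.

(** The set where f is at least q fills at least the fraction 1 - eta of [T]. *)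
Lemma integral_ge_off (f : 'rV[R]_n -> R) (T F : set (Rn R n)) (q eta : R) :
  measurable_fun setT (EFin \o f : Rn R n -> \bar R) -> (forall x, 0 <= f x) ->
  measurable T -> measurable F -> (mu T < +oo)%E ->
  0 <= q -> (forall x, T x -> ~ F x -> q <= f x) ->
  (mu (F `&` T) <= eta%:E * mu T)%E ->
  ((q * (1 - eta))%:E * mu T <= \int[mu]_(y in T) (f y)%:E)%E.
Proof.
move=> mf f0 mT mF Tfin q0 qf FT.
have Tf : mu T \is a fin_num by rewrite ge0_fin_numE// measure_ge0.
have mTF : measurable (T `\` F) by exact: measurableD.
have h1 : (q%:E * mu (T `\` F) <= \int[mu]_(y in T) (f y)%:E)%E.
  rewrite -integral_cst//.
  apply: (@le_trans _ _ (\int[mu]_(y in T `\` F) (f y)%:E)%E).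
    apply: ge0_le_integral; [exact: mTF| | | |].
    - by move=> y _; rewrite lee_fin.
    - exact: measurable_cst.
    - exact: measurable_funS mf.
    - by move=> y [Ty nFy]; rewrite lee_fin qf.
  apply: ge0_subset_integral; [exact: mTF|exact: mT| | |].
  - exact: measurable_funS mf.
  - by move=> y _; rewrite lee_fin.
  - by move=> y [].
apply: le_trans h1.
have h2 : (mu T <= mu (T `\` F) + eta%:E * mu T)%E.
  apply: (@le_trans _ _ (mu (T `\` F) + mu (F `&` T))%E); last exact: leeD2l.
  apply: le_trans (outer_measureU2 (lebesgue_outer_measure R n) _ _).
  apply: le_lebesgue_outer => y Ty.
  by have [Fy|nFy] := pselect (F y); [right|left].
rewrite EFinM -muleA; apply: lee_wpmul2l; first by rewrite lee_fin.
apply: le_trans (_ : _ <= mu T - eta%:E * mu T)%E _.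
  by rewrite -(fineK Tf) -!EFinM -EFinB lee_fin mulrBl mul1r.
by rewrite leeBlDr// fin_numM.
Qed.

End derivatives.

Lemma nat_frac_approx {R : realType} (m : nat) (y : R) : 0 <= y ->
  exists j : nat, j%:R / m.+1%:R <= y < j%:R / m.+1%:R + m.+1%:R^-1.
Proof.
move=> y0; have m0 : 0 < m.+1%:R :> R by [].
exists (Num.trunc (y * m.+1%:R)).
have /andP[h1 h2] := truncn_itv (mulr_ge0 y0 (ltW m0)).
rewrite ler_pdivrMr// h1/= -[X in _ + X]mul1r -mulrDl ltr_pdivlMr//.
by rewrite -[1]/(1%:R) -natrD addn1.
Qed.

(** * Lower derivatives and finiteness of upper derivatives *)

Section bounds.
Context {R : realType} {n : nat}.
Variable B : 'rV[R]_n -> set (set 'rV[R]_n).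
Hypotheses (basisB : differentiation_basis B) (transB : translation_invariant B)
  (convexB : convex_basis B) (densityB : density_basis B).
Local Notation mu := (@lebesgue R n).
Local Notation BF := (busemann_feller B).

Let basisBF : differentiation_basis BF := busemann_feller_basis basisB.

Variable f : 'rV[R]_n -> R.
Hypotheses (mf : measurable_fun setT (EFin \o f : Rn R n -> \bar R))
  (f0 : forall x, 0 <= f x).

(** For a grid value q = j/(m+1) just below f(x), the part of {f < q} in a cube is sparse in the
    small sets at almost every such x, and f is at least q on the rest of these sets. *)
Lemma lower_busemann_feller_ge :
  {ae mu, forall x, ((f x)%:E <= lower_derivative BF f x)%E}.
Proof.
pose F (m j k : nat) : set (Rn R n) :=
  cube (k%:R + 1) `&` [set x | ((EFin \o f) x < (j%:R / m.+1%:R)%:E)%E].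
have mF m j k : measurable (F m j k).
  apply: measurableI; first exact: cube_measurable.
  have := emeasurable_fun_infty_o measurableT mf (j%:R / m.+1%:R)%:E.
  by rewrite setTI.
have bF m j k : bounded_set (F m j k : set 'rV[R]_n).
  have := @cube_bounded R n (k%:R + 1);
    rewrite addr_ge0// => /(_ isT) [M [Mr h]].
  by exists M; split=> // K MK x [] /(h K MK).
have h := ae_forall_nat (fun m => ae_forall_nat (fun j => ae_forall_nat (fun k
  =>
  sparse_busemann_feller basisB transB convexB densityB (bF m j k) (mF m j
    k)))).
apply: ae_mono h => x xF;
  suff H (e : R) : 0 < e -> ((f x - e)%:E <= lower_derivative BF f x)%E.
  by apply/lee_subgt0Pr => e; exact: H.
move=> e0; have [m me] := nat_inv_lt (divr_gt0 e0 (ltr0n _ 2)).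
have [j] := nat_frac_approx m (f0 x).
set q : R := j%:R / m.+1%:R => /andP[qf fq].
have [k _ xk] : (\bigcup_k cube k%:R) x by rewrite bigcup_cube.
have q0 : 0 <= q by rewrite divr_ge0.
have nF : ~ F m j k x by move=> [_] /=; rewrite lte_fin ltNge => /negP; apply.
(* With this choice the loss q * eta is at most e/2; the grid accounts for the other half of e. *)
have eta0 : 0 < e / 2 / (q + 1) by rewrite !divr_gt0// ltr_wpDl.
have [d d0 dP] := xF m j k nF _ eta0.
(* A diameter below 1 keeps [T] in the enlarged cube, so that points of [T] off [F m j k] satisfy q
   <= f. *)
apply: (@lower_derivative_ge _ _ _ _ _ _ (Num.min d 1));
  first by rewrite lt_min d0 ltr01.
move=> T BT; rewrite EFin_min lt_min => /andP[Td T1].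
have [mT T0 Tfin Tx] := basisP basisBF BT.
rewrite mean_ge//.
have off y : T y -> ~ F m j k y -> q <= f y.
  move=> Ty nFy; rewrite leNgt; apply/negP => fyq; apply: nFy; split.
    exact: small_sub_cube T1 Tx xk _ Ty.
  by rewrite /= lte_fin.
have := integral_ge_off mf f0 mT (mF m j k) Tfin q0 off (dP T BT Td).
apply: le_trans; apply: lee_wpmul2r; first exact: measure_ge0.
rewrite lee_fin mulrBr mulr1.
have : q * (e / 2 / (q + 1)) <= e / 2.
  rewrite mulrCA ger_pMr ?divr_gt0// ler_pdivrMr ?mul1r; lra.
rewrite lerBlDr => te; apply: ltW; apply: lt_le_trans fq _.
rewrite -addrA lerD2l; apply: le_trans (ltW me) _.
by move: te; set t := q * _ => te; lra.
Qed.

Lemma lower_derivative_ge_ae :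
  {ae mu, forall x, ((f x)%:E <= lower_derivative B f x)%E}.
Proof.
apply: ae_mono lower_busemann_feller_ge => x /le_trans; apply.
exact: lower_busemann_feller.
Qed.

Lemma limn_einf_ge (u : (\bar R)^nat) c K : (forall k, (K <= k)%N -> (c <= u
  k)%E) ->
  (c <= limn_einf u)%E.
Proof.
move=> h; rewrite limn_einf_lim (cvg_lim _ (@cvg_einfs_sup _ u))//.
apply: (@le_trans _ _ (einfs u K)); last by apply: ereal_sup_ubound; exists K.
by apply: le_ereal_inf_tmp => _ [k /= Kk <-]; exact: h.
Qed.

Hypothesis fL1 : L1 f.

(** Let [L] be the lower limit of the means along one shrinking sequence of [B 0]. Almost everywhere
    f is at most the lower derivative, hence at most [L], while Fatou's lemma bounds the integral of
    [L] by the finite integral of f. So f = [L] almost everywhere. *)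
Lemma lower_derivative_le_ae :
  {ae mu, forall x, (lower_derivative B f x <= (f x)%:E)%E}.
Proof.
have [_ [S_ [BS S0]]] := basisB 0.
have SP k := basisP basisB (BS k).
have mS k : measurable (S_ k : set (Rn R n)) by case: (SP k).
have S_gt0 k : (0 < mu (S_ k))%E by case: (SP k).
have S_fin k : (mu (S_ k) < +oo)%E by case: (SP k).
have Sf k : mu (S_ k) \is a fin_num by rewrite ge0_fin_numE// ltW.
pose g : Rn R n -> \bar R := EFin \o f.
have g0 x : (0 <= g x)%E by rewrite lee_fin.
pose c k : \bar R := ((fine (mu (S_ k)))^-1)%:E.
have c0 k : (0 <= c k)%E by rewrite lee_fin invr_ge0 fine_ge0.
(* [u k x] is the mean of f over x + S_k; Tonelli's theorem with the constant 1/|S_k| shows that it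
   has the same integral as f. *)
pose u k (x : Rn R n) : \bar R := (c k * \int[mu]_(z in (translate (S_ k) x :
  set (Rn R n))) g z)%E.
have u0 k x : (0 <= u k x)%E by apply: mule_ge0 => //;
  apply: integral_ge0 => z _; exact: g0.
have tone k := tonelli_translates mf (@measurable_cst _ _ _ _ setT (c k)) g0
  (fun=> c0 k)
  (mS k) (S_fin k).
have mu_ k : measurable_fun setT (u k) by have [h _] := tone k; exact: h.
have uint k : (\int[mu]_x u k x = \int[mu]_x g x)%E.
  have [_ tE] := tone k; apply: etrans tE _; apply: eq_integral => z _.
  have -> : (\int[mu]_(y in (reflected (S_ k) z : set (Rn R n))) cst (c k) y =
    1)%E.
    apply: etrans (integral_cst mu (measurable_rf z (mS k)) (c k)) _.
    rewrite (lebesgue_rf (S_ k) z : mu (reflected (S_ k) z) = mu (S_ k)) /c -[X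
      in (_ * X)%E](fineK (Sf k)) -EFinM mulVf//.
    by rewrite gt_eqF// fine_gt0// S_gt0/= ltey_eq Sf.
  by rewrite mule1.
pose L (x : Rn R n) := limn_einf (u ^~ x).
have mL : measurable_fun setT L.
  have h : measurable_fun setT (fun x : Rn R n => limn_esup (fun k => - u k
    x)%E).
    by apply: measurable_fun_limn_esup => k; apply: measurableT_comp => //;
      exact: mu_.
  by rewrite /L /limn_einf; apply: measurableT_comp => //; exact: h.
have L0 x : (0 <= L x)%E by apply: (@limn_einf_ge _ _ 0) => k _; exact: u0.
have LD x : (lower_derivative B f x <= L x)%E.
  apply: ge_ereal_sup => _ [d /= d0 <-].
  have : \forall k \near \oo, (diam (S_ k) < d%:E)%E.
    move/fine_cvgP : S0 => [fin cv]; near=> k.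
    have fk : diam (S_ k) \is a fin_num by near: k.
    by rewrite -(fineK fk) lte_fin; near: k; exact: (cvgr_lt 0 cv).
  move=> [K _ Kd]; apply: (@limn_einf_ge _ _ K) => k /Kd /= kd.
  apply: ereal_inf_lbound; exists (translate (S_ k) x).
    by split; [exact: basis_tr|rewrite diam_tr].
  rewrite /mean /u /c (lebesgue_tr (S_ k) x : lebesgue (translate (S_ k) x) =
    mu (S_ k)).
  by rewrite -[in LHS](fineK (Sf k)) inver gt_eqF// fine_gt0// S_gt0/= ltey_eq
    Sf.
have fL : {ae mu, forall x, (g x <= L x)%E}.
  by apply: ae_mono lower_derivative_ge_ae => x /le_trans; apply; exact: LD.
have Lint : (\int[mu]_x L x <= \int[mu]_x g x)%E.
  apply: le_trans (fatou mu measurableT mu_ (fun k x _ => u0 k x)) _.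
  under eq_fun do rewrite uint.
  by rewrite (cvg_limn_einf_sup (cvg_cst _)).1.
have gLE E : measurable E -> (\int[mu]_(x in E) g x <= \int[mu]_(x in E) L x)%E.
  move=> mE; apply: ae_ge0_le_integral => //.
  - exact: measurable_funS mf.
  - exact: measurable_funS mL.
  - by apply: ae_mono fL => x.
have gfin : (\int[mu]_x g x < +oo)%E.
  have /integrableP[_] := fL1; apply: le_lt_trans.
  apply: ge0_le_integral; [exact: measurableT|by move=> x _;
    exact: g0|exact: mf| |].
    exact: (measurableT_comp (@abse_measurable _ _) mf).
  by move=> x _; exact: lee_abs.
(* The finite integral over the complement, where g is below [L], is subtracted from the global
   inequality. *)
have LE E : measurable E -> (\int[mu]_(x in E) L x <= \int[mu]_(x in E) g x)%E.
  move=> mE; have mCE : measurable (~` E) by exact: measurableC.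
  have split_ (h : Rn R n -> \bar R) : measurable_fun setT h -> (forall x, 0 <=
    h x)%E ->
      (\int[mu]_x h x = \int[mu]_(x in E) h x + \int[mu]_(x in ~` E) h x)%E.
    move=> mh h0; rewrite -ge0_integral_setU ?setUv//.
    by apply/disj_set2P; rewrite setICr.
  move: Lint; rewrite (split_ L mL L0) (split_ g mf g0) => Lint.
  have bfin : (\int[mu]_(x in ~` E) g x)%E \is a fin_num.
    rewrite ge0_fin_numE; last by apply: integral_ge0 => x _; exact: g0.
    apply: le_lt_trans gfin; apply: ge0_subset_integral => //.
  rewrite -(leeD2rE _ _ bfin); apply: le_trans Lint.
  by apply: leeD2l; exact: gLE.
have eqgL : ae_eq mu setT g L.
  apply: integral_ae_eq => // E _ mE.
  by apply/eqP; rewrite eq_le gLE//= LE.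
apply: ae_mono eqgL => x /(_ I) gL.
by apply: le_trans (LD x) _; rewrite -gL.
Unshelve. all: by end_near.
Qed.

(** The points with finite upper derivative are exhausted by the sets where it is below j+1; on
    each, f has bounded means and [busemann_feller_le] applies. *)
Lemma upper_derivative_lty_ae : {ae mu, forall x,
  (upper_derivative B f x < +oo)%E -> (upper_derivative BF f x < +oo)%E}.
Proof.
pose A (j : nat) : set 'rV[R]_n := [set x | (upper_derivative B f x <
  j.+1%:R%:E)%E].
have h : {ae mu, forall x, forall j : nat, A j x -> exists2 d : R, 0 < d &
    forall T : set (Rn R n), BF x T -> (diam T < d%:E)%E ->
    (\int[mu]_(z in T) (f z)%:E <= (2 * 8 ^+ n * j.+1%:R)%:E * mu T)%E}.
  apply: ae_forall_nat => j.
  have j0 : 0 < j.+1%:R :> R by [].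
  have g0 (x : Rn R n) : (0 <= (EFin \o f) x)%E by rewrite lee_fin.
  apply: (busemann_feller_le basisB transB convexB densityB mf g0 j0).
  apply: aeW => x /upper_derivative_lt[d d0 dP]; exists d => // S BS Sd.
  have BxS := basis_tr transB x BS.
  have [_ T0 Tfin _] := basisP basisB BxS.
  have := dP _ BxS; rewrite diam_tr => /(_ Sd).
  by rewrite mean_le// (lebesgue_tr S x : mu (translate S x) = mu S).
apply: ae_mono h => x xA ux.
have [j Aj] : exists j, A j x.
  move: ux; rewrite /A/=; case: (upper_derivative B f x) => [r _|//|_].
    exists (Num.bound `|r|); rewrite lte_fin.
    apply: le_lt_trans (ler_norm r) _.
    apply: lt_le_trans (archi_boundP (normr_ge0 r)) _.
    by rewrite ler_nat leqnSn.
  by exists 0; rewrite ltNyr.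
have [d d0 dP] := xA j Aj.
apply: le_lt_trans (ltry (2 * 8 ^+ n * j.+1%:R)).
apply: (upper_derivative_le d0) => T BT Td.
have [_ T0 Tfin _] := basisP basisBF BT.
by rewrite mean_le//; exact: dP.
Qed.

End bounds.

(** * Upper derivatives equal to the function *)

Section upper_equality.
Context {R : realType} {n : nat}.
Variable B : 'rV[R]_n -> set (set 'rV[R]_n).
Hypotheses (basisB : differentiation_basis B) (transB : translation_invariant B)
  (convexB : convex_basis B) (densityB : density_basis B).
Local Notation mu := (@lebesgue R n).
Local Notation BF := (busemann_feller B).

Let basisBF : differentiation_basis BF := busemann_feller_basis basisB.

Variable f : 'rV[R]_n -> R.
Hypotheses (mf : measurable_fun setT (EFin \o f : Rn R n -> \bar R))
  (f0 : forall x, 0 <= f x).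

(** f is split at the level q as [lo] + [hi]: [lo] is bounded by q, and only [hi] is submitted to
    the lossy factor of [busemann_feller_le]. *)
Let lo (q : R) (x : 'rV[R]_n) : R := Num.min (f x) q.
Let hi (q : R) (x : 'rV[R]_n) : R := Num.max (f x - q) 0.

Let mlo q : measurable_fun setT (EFin \o lo q : Rn R n -> \bar R).
Proof.
apply/measurable_EFinP; apply: measurable_minr; last exact: measurable_cst.
exact/measurable_EFinP.
Qed.

Let mhi q : measurable_fun setT (EFin \o hi q : Rn R n -> \bar R).
Proof.
apply/measurable_EFinP; apply: measurable_maxr; last exact: measurable_cst.
by apply: measurable_funB; [exact/measurable_EFinP|exact: measurable_cst].
Qed.

Let lo_ge0 q x : 0 <= q -> 0 <= lo q x.
Proof. by move=> q0; rewrite le_min f0. Qed.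

Let hi_ge0 q (x : Rn R n) : (0 <= (EFin \o hi q) x)%E.
Proof. by rewrite lee_fin le_max lexx orbT. Qed.

Let integral_lo_hi (T : set (Rn R n)) q : measurable T -> 0 <= q ->
  (\int[mu]_(x in T) (f x)%:E =
   \int[mu]_(x in T) (lo q x)%:E + \int[mu]_(x in T) (hi q x)%:E)%E.
Proof.
move=> mT q0; rewrite -ge0_integralD; [|exact: mT| | | |].
- apply: eq_integral => x _; rewrite -EFinD; congr EFin.
  by rewrite /lo /hi; case: (leP (f x) q) => h; case: leP => h'; lra.
- by move=> x _; rewrite lee_fin lo_ge0.
- exact: measurable_funS (mlo q).
- by move=> x _; exact: hi_ge0.
- exact: measurable_funS (mhi q).
Qed.

(** If f and its truncation both have means near q, the excess above q has a small mean. *)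
Let sub_bound (T : set (Rn R n)) q (e : R) :
  measurable T -> (mu T < +oo)%E -> 0 <= q ->
  ((q - e)%:E * mu T <= \int[mu]_(x in T) (lo q x)%:E)%E ->
  (\int[mu]_(x in T) (f x)%:E <= (q + e)%:E * mu T)%E ->
  (\int[mu]_(x in T) (hi q x)%:E <= (2 * e)%:E * mu T)%E.
Proof.
move=> mT Tfin q0 h1 h2.
have Tf : mu T \is a fin_num by rewrite ge0_fin_numE// measure_ge0.
have qf : ((q - e)%:E * mu T)%E \is a fin_num by rewrite fin_numM.
rewrite -(leeD2lE _ _ qf); apply: le_trans (leeD2r _ h1) _.
rewrite -integral_lo_hi//; apply: le_trans h2 _.
by rewrite -(fineK Tf) -!EFinM -EFinD lee_fin; lra.
Qed.

(** For q just below f(x), the means of [hi] over small x + S are at most 2/(m+1). Over the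
    extension they grow at most by a constant factor, which vanishes in the limit, and [lo]
    contributes at most q <= f(x). *)
Lemma upper_busemann_feller_le_ae : {ae mu, forall x,
  upper_derivative B f x = (f x)%:E -> (upper_derivative BF f x <= (f x)%:E)%E}.
Proof.
pose q (m j : nat) : R := j%:R / m.+1%:R.
have q0 m j : 0 <= q m j by rewrite divr_ge0.
pose A m j : set 'rV[R]_n := [set x | q m j <= f x < q m j + m.+1%:R^-1 /\
  upper_derivative B f x = (f x)%:E].
(* The last factor 2 is the one of [sub_bound]. *)
pose C : R := 2 * 8 ^+ n * 2.
have C0 : 0 < C by rewrite !mulr_gt0// exprn_gt0.
have h : {ae mu, forall x, forall m j : nat, A m j x -> exists2 d : R, 0 < d &
    forall T : set (Rn R n), BF x T -> (diam T < d%:E)%E ->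
    (\int[mu]_(z in T) (hi (q m j) z)%:E <= (2 * 8 ^+ n * (2 * m.+1%:R^-1))%:E
      * mu T)%E}.
  apply: ae_forall_nat => m; apply: ae_forall_nat => j.
  have m0 : 0 < m.+1%:R^-1 :> R by rewrite invr_gt0.
  have m2 : 0 < 2 * m.+1%:R^-1 :> R by rewrite mulr_gt0.
  apply: (busemann_feller_le basisB transB convexB densityB (mhi _) (hi_ge0 _)
    m2).
  (* Applied to the truncation, which takes the value q at x: its means are eventually above q -
     1/(m+1). *)
  have := lower_derivative_ge_ae basisB transB convexB densityB (mlo (q m j))
    (fun x => lo_ge0 x (q0 m j)).
  apply: ae_mono => x xlo [/andP[qf fq] ux].
  have {xlo} : ((q m j - m.+1%:R^-1)%:E < lower_derivative B (lo (q m j)) x)%E.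
    apply: lt_le_trans xlo; rewrite lte_fin /lo (min_idPr qf).
    by rewrite ltrBlDr ltrDl.
  move=> /lower_derivative_gt[d1 d10 d1P].
  have : (upper_derivative B f x < (q m j + m.+1%:R^-1)%:E)%E by rewrite ux
    lte_fin.
  move=> /upper_derivative_lt[d2 d20 d2P].
  have e1 : for_small B (fun S => (diam S < d1%:E)%E) by exists d1.
  have e2 : for_small B (fun S => (diam S < d2%:E)%E) by exists d2.
  apply: for_small_mono (for_small_and e1 e2) => S BS [Sd1 Sd2].
  have BxS := basis_tr transB x BS.
  have [mT T0 Tfin _] := basisP basisB BxS.
  have := d1P _ BxS; rewrite diam_tr mean_ge// => /(_ Sd1) h1.
  have := d2P _ BxS; rewrite diam_tr mean_le// => /(_ Sd2) h2.
  have := sub_bound mT Tfin (q0 m j) h1 h2.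
  by rewrite (lebesgue_tr S x : mu (translate S x) = mu S).
apply: ae_mono h => x xA ux.
suff H (e : R) : 0 < e -> (upper_derivative BF f x <= (f x + e)%:E)%E.
  by apply/lee_addgt0Pr => e; exact: H.
move=> e0; have [m me] := nat_inv_lt (divr_gt0 e0 C0).
have [j qfq] := nat_frac_approx m (f0 x).
have Ax : A m j x by split.
have [d d0 dP] := xA m j Ax.
apply: (upper_derivative_le d0) => T BT Td.
have [mT T0 Tfin _] := basisP basisBF BT.
have Tf : mu T \is a fin_num by rewrite ge0_fin_numE// ltW.
rewrite mean_le// (integral_lo_hi mT (q0 m j)).
have hlo : (\int[mu]_(y in T) (lo (q m j) y)%:E <= (q m j)%:E * mu T)%E.
  rewrite -integral_cst//; apply: ge0_le_integral; [exact: mT| | | |].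
  - by move=> y _; rewrite lee_fin lo_ge0.
  - exact: measurable_funS (mlo _).
  - exact: measurable_cst.
  - by move=> y _; rewrite lee_fin ge_min lexx orbT.
apply: le_trans (leeD hlo (dP T BT Td)) _.
rewrite -(fineK Tf) -!EFinM -EFinD lee_fin -mulrDl ler_wpM2r ?fine_ge0//.
have /andP[qf _] := qfq.
apply: lerD => //; rewrite mulrA -/C mulrC -ler_pdivlMr//; exact: ltW.
Qed.

End upper_equality.

(** * Comparison of differentiability and of types *)

Theorem theorem1 (R : realType) (n : nat) (hn : (2 <= n)%N)
    (B : 'rV[R]_n -> set (set 'rV[R]_n))
    (basisB : differentiation_basis B)
    (transB : translation_invariant B)
    (convexB : convex_basis B)
    (densityB : density_basis B) :
  (forall f : 'rV[R]_n -> R, L1 f -> (forall x, 0 <= f x) ->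
     (differentiates B f <-> differentiates (busemann_feller B) f)) /\
  (forall f : 'rV[R]_n -> R, L1 f -> (forall x, 0 <= f x) ->
     {ae @lebesgue R n, forall x, exists t : indeterminacy_type,
        has_indeterminacy_type B f x t /\
        has_indeterminacy_type (busemann_feller B) f x t}).
Proof.
have basisBF := busemann_feller_basis basisB.
have facts (f : 'rV[R]_n -> R) : L1 f -> (forall x, 0 <= f x) ->
  {ae @lebesgue R n, forall x, [/\
    lower_derivative B f x = (f x)%:E,
    lower_derivative (busemann_feller B) f x = (f x)%:E,
    ((f x)%:E <= upper_derivative B f x)%E,
    (upper_derivative B f x < +oo -> upper_derivative (busemann_feller B) f x <
      +oo)%E &
    (upper_derivative B f x = (f x)%:E ->
     upper_derivative (busemann_feller B) f x = (f x)%:E)]}.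
  move=> fL1 f0; have mf := measurable_int _ fL1.
  have h1 := lower_busemann_feller_ge basisB transB convexB densityB mf f0.
  have h2 := lower_derivative_le_ae basisB transB convexB densityB mf f0 fL1.
  have h3 := upper_derivative_lty_ae basisB transB convexB densityB mf f0.
  have h4 := upper_busemann_feller_le_ae basisB transB convexB densityB mf f0.
  apply: ae_mono (ae_and (ae_and h1 h2) (ae_and h3 h4)) => x [[l1 l2] [u1 u2]].
  have l3 := lower_busemann_feller basisB f x.
  have u3 := upper_busemann_feller basisB f x.
  have lu := lower_le_upper basisB f x.
  have fu := le_trans l1 (le_trans l3 lu).
  split=> //.
  - by apply/eqP; rewrite eq_le l2 (le_trans l1).
  - by apply/eqP; rewrite eq_le l1 (le_trans l3).
  - by move=> e; apply/eqP; rewrite eq_le u2//= (le_trans fu).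
split=> f fL1 f0; have fP := facts f fL1 f0.
  split=> D.
    by apply: ae_mono (ae_and fP D) => x [[? lBF _ _ uBF] [u _]]; split=> //;
      exact: uBF.
  (* Conversely, the upper derivative for [B] is squeezed between f(x) and the one for the
     extension. *)
  apply: ae_mono (ae_and fP D) => x [[lB _ fu _ _] [u _]]; split=> //.
  apply/eqP; rewrite eq_le fu andbT -u; exact: upper_busemann_feller.
apply: ae_mono fP => x [lB lBF fu uy ueq].
rewrite /has_indeterminacy_type lB lBF.
have u3 := upper_busemann_feller basisB f x.
(* With both lower derivatives equal to f(x), the type is vi, i or vii according to whether the
   upper derivative for [B] is infinite, equal to f(x) or strictly between; each case passes to the
   extension. *)
have [uoo|ufin] := eqVneq (upper_derivative B f x) +oo%E.
  exists Type_vi; rewrite /= uoo ltNyr ltry; split=> //.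
  split=> //; first by apply: lt_le_trans u3; rewrite uoo ltry.
  by apply/eqP; rewrite -leye_eq -uoo.
have {}ufin : (upper_derivative B f x < +oo)%E by rewrite ltey.
have [ueq1|une] := eqVneq (upper_derivative B f x) (f x)%:E.
  by exists Type_i; rewrite /= ueq1 ueq// ltNyr ltry.
have lt1 : ((f x)%:E < upper_derivative B f x)%E by rewrite lt_neqAle eq_sym
  une.
exists Type_vii; rewrite /= ltNyr lt1 ufin uy//.
by split=> //; split=> //; exact: lt_le_trans u3.
Qed.
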